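(* The essential range of the contravariant functor $\mathcal{P}:\mathbf{SDS}\to\mathbf{OBD}$ is $\mathbf{OBD}_{\mathrm{po}}$; that is, an ordered Bratteli diagram is isomorphic in $\mathbf{OBD}$ to $\mathcal{P}(\mathcal{X})$ for some $\mathcal{X}$ in $\mathbf{SDS}$ if and only if it is properly ordered.
   Context: **Bratteli diagrams.** A Bratteli diagram $(V,E)$ consists of a vertex set $V=V_0\sqcup V_1\sqcup\cdots$ with each $V_n$ finite and non-empty and $V_0$ a singleton, and an edge set $E=E_1\sqcup E_2\sqcup\cdots$ with each $E_n$ finite and non-empty, together with maps $r,s:E\to V$ (range, source) such that $r(E_n)\subseteq V_n$, $s(E_n)\subseteq V_{n-1}$, $s^{-1}\{v\}\neq\varnothing$ for all $v\in V$ and $r^{-1}\{v\}\ne\varnothing$ for all $v\in V\setminus V_0$. An ordered Bratteli diagram $(V,E,\geq)$ is a Bratteli diagram with a partial order on $E$ such that $e,e'$ are comparable iff $r(e)=r(e')$. It is properly ordered if there is exactly one infinite path $(e_1,e_2,\ldots)$ ($e_i\in E_i$, $r(e_i)=s(e_{i+1})$) consisting of maximal edges, and exactly one consisting of minimal edges. **Edge sets.** An ordered edge set from a finite set $S$ to a finite set $T$ is a finite set $F$ with maps $s:F\to S$, $r:F\to T$ and a linear order on each $r^{-1}\{w\}$, $w\in T$. If $G$ is an ordered edge set from $T$ to $U$, then $F\circ G=\{(e,g)\in F\times G: r(e)=s(g)\}$, with source $s(e)$, range $r(g)$, and order: for $r(g)=r(g')$, $(e,g)<(e',g')$ iff $g<g'$,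 or $g=g'$ and $e<e'$. Write $F\cong F'$ if there is a bijection $F\to F'$ preserving sources, ranges and order. For $k<l$, $E_{k,l}=E_{k+1}\circ\cdots\circ E_l$; $E_{k,k}$ consists of one edge from $v$ to $v$ for each $v\in V_k$. **The category $\mathbf{OBD}$.** Objects: ordered Bratteli diagrams. An ordered premorphism $f:B=(V,E,\ge)\to C=(W,S,\ge)$ is a triple $(F,(f_n)_{n\ge0},\geq)$ where $(f_n)$ is an unbounded sequence of integers with $0=f_0\le f_1\le\cdots$, and $F=F_0\sqcup F_1\sqcup\cdots$ where each $F_n$ is a non-empty finite ordered edge set from $V_n$ to $W_{f_n}$ such that every $v\in V_n$ is the source and every $w\in W_{f_n}$ the range of some edge of $F_n$, $F_0$ is a singleton, and $E_{n+1}\circ F_{n+1}\cong F_n\circ S_{f_n,f_{n+1}}$ for all $n\ge0$. The composition of $f:B\to C$ and $g=(G,(g_n),\ge):C\to D$ is $gf=(H,(h_n),\ge)$ with $h_n=g_{f_n}$, $H_n=F_n\circ G_{f_n}$. Premorphisms $f,g:B\to C$ are equivalent if there are positive integers $n_1<m_1<n_2<m_2<\cdots$ with $f_{n_k}<g_{m_k}<f_{n_{k+1}}$ and, for all $k\ge1$, $E_{n_k,m_k}\circ G_{m_k}\cong F_{n_k}\circ S_{f_{n_k},g_{m_k}}$ and $E_{m_k,n_{k+1}}\circ F_{n_{k+1}}\cong G_{m_k}\circ S_{g_{m_k},f_{n_{k+1}}}$. Morphisms in $\mathbf{OBD}$ are equivalence classes $[f]$, with $[g][f]=[gf]$. $\mathbf{OBD}_{\mathrm{po}}$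 is the full subcategory of properly ordered Bratteli diagrams. **Objects of $\mathbf{SDS}$.** An essentially minimal totally disconnected dynamical system $(X,\varphi,x_0)$ consists of a metrizable compact totally disconnected space $X$, a homeomorphism $\varphi$ of $X$ such that $(X,\varphi)$ has a unique minimal (non-empty closed invariant) subset, and a point $x_0$ of that subset. A Kakutani–Rokhlin partition for it is a finite partition $P=\{Z(k,j): 1\le k\le K,\ 1\le j\le J(k)\}$ of $X$ into non-empty clopen sets with $\varphi(Z(k,j))=Z(k,j+1)$ for $1\le j<J(k)$, and such that the top $Z=\bigcup_kZ(k,J(k))$ contains $x_0$ and $\varphi(Z)=\bigcup_kZ(k,1)$; the sequences $(Z(k,1),\ldots,Z(k,J(k)))$ are its towers. A system of Kakutani–Rokhlin partitions is a sequence $\mathcal{R}=(P_n)_{n\ge0}$ of such partitions with $P_0=\{X\}$, $P_{n+1}$ refining $P_n$ (written $P_n\le P_{n+1}$), the tops $Z_n$ of $P_n$ ($n\ge1$) decreasing with intersection $\{x_0\}$, and $\bigcup_nP_n$ a basis for the topology of $X$. Objects of $\mathbf{SDS}$ are quadruples $(X,\varphi,x_0,\mathcal{R})$. **$\mathcal{P}$ on objects.** If $P\le Q$ are Kakutani–Rokhlin partitions and the top of $P$ contains the top of $Q$, $E(P,Q)$ is the set of triples $(S,T,k)$ with $S=(Z_1,\ldots,Z_n)$ a tower of $P$, $T=(Y_1,\ldots,Y_m)$ a tower of $Q$, $k\ge0$ an integer with $Y_{k+j}\subseteq Z_j$ for $1\le j\le n$; source $S$, range $T$, and $(S,T,k)\le(S',T',k')$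 iff $T=T'$ and $k\le k'$. For $\mathcal{R}=(P_n)$, $\mathcal{P}(X,\varphi,x_0,\mathcal{R})$ is the ordered Bratteli diagram with $V_n=\{(n,T): T\text{ a tower of }P_n\}$ and $E_n$ the copy $\{(n,S,T,k):(S,T,k)\in E(P_{n-1},P_n)\}$ of $E(P_{n-1},P_n)$ with its order. *)

(* Defs.v *)
From HB Require Import structures.
From mathcomp Require Import all_boot all_order all_algebra.
From mathcomp Require Import all_classical reals topology.

Set Implicit Arguments.
Unset Strict Implicit.
Unset Printing Implicit Defensive.

Import Order.TTheory GRing.Theory Num.Theory.

Local Open Scope classical_set_scope.

(* The family of linear orders on the fibres of the range map is encoded as
   one partial order on all edges, in which two edges are comparable exactly
   when they have the same range. *)
Record oedge (S T : Type) := OEdge {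
  edge :> finType;
  src : edge -> S;
  rng : edge -> T;
  ele : rel edge;
  ele_refl : reflexive ele;
  ele_anti : antisymmetric ele;
  ele_trans : transitive ele;
  ele_comparable : forall e e', (ele e e' || ele e' e) <-> rng e = rng e'
}.
Arguments src {S T} _ _.
Arguments rng {S T} _ _.
Arguments ele {S T} _ _ _.
Arguments ele_comparable {S T} _ _ _.

Section Composition.
Variables (S T U : Type) (F : oedge S T) (G : oedge T U).

Definition ocomp_edge : Type := {p : F * G | `[< rng F p.1 = src G p.2 >]}.
HB.instance Definition _ := Finite.on ocomp_edge.

Definition ofst (p : ocomp_edge) : F := (val p).1.
Definition osnd (p : ocomp_edge) : G := (val p).2.

Lemma ocomp_mid p : rng F (ofst p) = src G (osnd p).
Proof. exact: asboolW (valP p). Qed.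

Lemma ocomp_ext p q : ofst p = ofst q -> osnd p = osnd q -> p = q.
Proof.
by case: p q => [[e g] h] [[e' g'] h'] /= ee gg; apply: val_inj; congr pair.
Qed.

Definition ocomp_le (p q : ocomp_edge) : bool :=
  (osnd p != osnd q) && ele G (osnd p) (osnd q)
  || (osnd p == osnd q) && ele F (ofst p) (ofst q).

Fact ocomp_le_refl : reflexive ocomp_le.
Proof. by move=> p; rewrite /ocomp_le eqxx /= ele_refl. Qed.

Fact ocomp_le_anti : antisymmetric ocomp_le.
Proof.
move=> p q; rewrite /ocomp_le [osnd q == _]eq_sym.
case: eqVneq => [eg|ne] /=.
  by move/ele_anti => ef; apply: ocomp_ext.
by rewrite !orbF => /ele_anti eg; rewrite eg eqxx in ne.
Qed.

Fact ocomp_le_trans : transitive ocomp_le.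
Proof.
move=> q p r; rewrite /ocomp_le.
case/orP=> /andP[]; last first.
  move=> /eqP-> l1 /orP[/andP[-> ->]//|/andP[/eqP-> l2]].
  by rewrite eqxx (ele_trans l1 l2) orbT.
move=> n1 l1 /orP[|] /andP[]; last by move=> /eqP<- _; rewrite n1 l1.
move=> n2 l2; rewrite (ele_trans l1 l2) andbT.
suff -> : osnd p != osnd r by [].
apply: contra_neq n1 => eg; rewrite -eg in l2.
by apply: (@ele_anti _ _ G); rewrite l1 l2.
Qed.

Fact ocomp_le_comparable p q :
  (ocomp_le p q || ocomp_le q p) <-> rng G (osnd p) = rng G (osnd q).
Proof.
rewrite /ocomp_le [osnd q == _]eq_sym.
case: eqVneq => [eg|_] /=; last by rewrite !orbF; exact: ele_comparable.
rewrite eg; split => // _; apply/ele_comparable.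
by rewrite !ocomp_mid eg.
Qed.

Definition ocomp : oedge S U :=
  @OEdge S U ocomp_edge (fun p => src F (ofst p)) (fun p => rng G (osnd p))
    ocomp_le ocomp_le_refl ocomp_le_anti ocomp_le_trans ocomp_le_comparable.

Definition opair (e : F) (g : G) (h : rng F e = src G g) : ocomp :=
  exist (fun p : F * G => `[< rng F p.1 = src G p.2 >]) (e, g) (asboolT h).

Lemma ofst_opair e g h : ofst (@opair e g h) = e. Proof. by []. Qed.
Lemma osnd_opair e g h : osnd (@opair e g h) = g. Proof. by []. Qed.

Lemma ocomp_eqE (p q : ocomp) :
  (p == q) = (ofst p == ofst q) && (osnd p == osnd q).
Proof. by case: p q => [[e g] h] [[e' g'] h']; rewrite -val_eqE. Qed.

Lemma ocomp_eleE (p q : ocomp) :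
  ele ocomp p q = (osnd p != osnd q) && ele G (osnd p) (osnd q)
                  || (osnd p == osnd q) && ele F (ofst p) (ofst q).
Proof. by []. Qed.

End Composition.

Definition oiso (S T : Type) (F F' : oedge S T) : Prop :=
  exists phi : F -> F', [/\ bijective phi,
    forall e, src F' (phi e) = src F e,
    forall e, rng F' (phi e) = rng F e &
    forall e e', ele F' (phi e) (phi e') = ele F e e'].

Lemma oiso_refl S T (F : oedge S T) : oiso F F.
Proof. by exists id; split => //; exists id. Qed.

Lemma oiso_sym S T (F F' : oedge S T) : oiso F F' -> oiso F' F.
Proof.
case=> f [[g fg gf] fs fr fl]; exists g; split => //; first by exists f.
- by move=> e; rewrite -fs gf.
- by move=> e; rewrite -fr gf.
- by move=> e e'; rewrite -fl !gf.
Qed.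

Lemma oiso_trans S T (F G H : oedge S T) : oiso F G -> oiso G H -> oiso F H.
Proof.
case=> f [bf fs fr fl] [g [bg gs gr gl]]; exists (g \o f); split => /=.
- exact: bij_comp.
- by move=> e; rewrite gs.
- by move=> e; rewrite gr.
- by move=> e e'; rewrite gl.
Qed.

Lemma ocomp_congr S T U (F F' : oedge S T) (G G' : oedge T U) :
  oiso F F' -> oiso G G' -> oiso (ocomp F G) (ocomp F' G').
Proof.
case=> f [[f' ff' f'f] fs fr fl] [g [[g' gg' g'g] gs gr gl]].
have h (p : ocomp F G) : rng F' (f (ofst p)) = src G' (g (osnd p)).
  by rewrite fr gs ocomp_mid.
have h' (p : ocomp F' G') : rng F (f' (ofst p)) = src G (g' (osnd p)).
  by rewrite -fr f'f -gs g'g ocomp_mid.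
exists (fun p => opair (h p)); split => /=.
- exists (fun p => opair (h' p)) => p; apply: ocomp_ext;
    by rewrite /ofst /osnd /= ?ff' ?gg' ?f'f ?g'g.
- by move=> e; exact: fs.
- by move=> e; exact: gr.
- move=> e e'; rewrite /ocomp_le /ofst /osnd /= fl gl.
  by rewrite (inj_eq (can_inj gg')).
Qed.

Lemma ocompA S T U W (F : oedge S T) (G : oedge T U) (H : oedge U W) :
  oiso (ocomp F (ocomp G H)) (ocomp (ocomp F G) H).
Proof.
have h1 (p : ocomp F (ocomp G H)) : rng F (ofst p) = src G (ofst (osnd p)).
  exact: (ocomp_mid p).
have h2 (p : ocomp F (ocomp G H)) :
    rng (ocomp F G) (opair (h1 p)) = src H (osnd (osnd p)).
  exact: (ocomp_mid (osnd p)).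
have k1 (p : ocomp (ocomp F G) H) : rng G (osnd (ofst p)) = src H (osnd p).
  exact: (ocomp_mid p).
have k2 (p : ocomp (ocomp F G) H) :
    rng F (ofst (ofst p)) = src (ocomp G H) (opair (k1 p)).
  exact: (ocomp_mid (ofst p)).
exists (fun p => opair (h2 p)); split => //.
- exists (fun p => opair (k2 p)).
    by move=> p; do 2?apply: ocomp_ext.
  by move=> p; do 2?apply: ocomp_ext.
- move=> p q; rewrite !ocomp_eleE ofst_opair osnd_opair ofst_opair osnd_opair.
  rewrite !ofst_opair !osnd_opair !ocomp_eqE.
  case: (eqVneq (osnd (osnd p))) => [->|_] /=; last by rewrite andbF !orbF.
  by case: (eqVneq (ofst (osnd p))) => [->|_] //=; rewrite !andbT ?orbF.
Qed.

(* [vert n] is V_n and [bedge n] is E_(n+1). Edges of different levels have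
   different ranges, so the partial order on E amounts to one on each level. *)
Record obd := OBD {
  vert : nat -> finType;
  bedge : forall n, oedge (vert n) (vert n.+1);
  vert0 : #|vert 0| = 1%N;
  vert_gt0 : forall n, (0 < #|vert n|)%N;
  bedge_gt0 : forall n, (0 < #|bedge n|)%N;
  src_surj : forall n (v : vert n), exists e, src (bedge n) e = v;
  rng_surj : forall n (v : vert n.+1), exists e, rng (bedge n) e = v
}.
Arguments bedge : clear implicits.

Definition inf_path (B : obd) (p : forall n, bedge B n) : Prop :=
  forall n, rng (bedge B n) (p n) = src (bedge B n.+1) (p n.+1).

Definition max_edge S T (F : oedge S T) (e : F) : Prop :=
  forall e', ele F e e' -> e' = e.

Definition min_edge S T (F : oedge S T) (e : F) : Prop :=
  forall e', ele F e' e -> e' = e.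

Definition properly_ordered (B : obd) : Prop :=
  (exists! p : forall n, bedge B n,
     inf_path p /\ forall n, max_edge (p n)) /\
  (exists! p : forall n, bedge B n,
     inf_path p /\ forall n, min_edge (p n)).

(* [odiag V k l] has one edge from v to v for each v : V k when k = l, and no
   edge when k <> l; having k and l distinct avoids casts in [span]. *)
Section Diagonal.
Variables (V : nat -> finType) (k l : nat).

Definition odiag_edge : Type :=
  {p : V k * V l | Tagged V p.1 == Tagged V p.2}.
HB.instance Definition _ := Finite.on odiag_edge.

Definition odiag_le (p q : odiag_edge) : bool := p == q.

Fact odiag_refl : reflexive odiag_le.
Proof. exact: eqxx. Qed.

Fact odiag_anti : antisymmetric odiag_le.
Proof. by move=> p q /andP[/eqP]. Qed.

Fact odiag_trans : transitive odiag_le.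
Proof. by move=> p q r /eqP->. Qed.

Fact odiag_comparable (p q : odiag_edge) :
  (odiag_le p q || odiag_le q p) <-> (val p).2 = (val q).2.
Proof.
rewrite /odiag_le [q == p]eq_sym orbb; split => [/eqP->//|].
case: p q => [[a b] /= h] [[a' b'] /= h'] bb; subst b'.
apply/eqP/val_inj => /=; congr pair.
have : Tagged V a == Tagged V a' by rewrite (eqP h) (eqP h').
by rewrite eq_Tagged => /eqP.
Qed.

Definition odiag : oedge (V k) (V l) :=
  @OEdge (V k) (V l) odiag_edge (fun p => (val p).1) (fun p => (val p).2)
    odiag_le odiag_refl odiag_anti odiag_trans odiag_comparable.

End Diagonal.

(* [span B k l] is E_(k,l); it is only meaningful for k <= l. *)
Fixpoint span (B : obd) (k l : nat) : oedge (vert B k) (vert B l) :=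
  match l with
  | 0 => odiag (vert B) k 0
  | l'.+1 => if k == l'.+1 then odiag (vert B) k l'.+1
             else ocomp (span B k l') (bedge B l')
  end.

Lemma span_id B k : span B k k = odiag (vert B) k k.
Proof. by case: k => //= k; rewrite eqxx. Qed.

Lemma spanS B k l : (k <= l)%N -> span B k l.+1 = ocomp (span B k l) (bedge B l).
Proof. by move=> kl /=; rewrite ltn_eqF. Qed.

Section DiagonalUnit.
Variables (V : nat -> finType) (k : nat).

Definition oloop (v : V k) : odiag V k k :=
  exist (fun p : V k * V k => Tagged V p.1 == Tagged V p.2) (v, v) (eqxx _).

Lemma oloop_srcK (d : odiag V k k) : oloop (src _ d) = d.
Proof.
case: d => [[a b] h]; apply: val_inj; congr pair => /=.
by apply/eqP; rewrite eq_Tagged in h.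
Qed.

Lemma oloop_rngK (d : odiag V k k) : oloop (rng _ d) = d.
Proof.
case: d => [[a b] h]; apply: val_inj; congr pair => /=.
by apply/esym/eqP; rewrite eq_Tagged in h.
Qed.

Lemma odiag_comp T (F : oedge (V k) T) : oiso (ocomp (odiag V k k) F) F.
Proof.
have h (e : F) : rng _ (oloop (src F e)) = src F e by [].
apply: oiso_sym; exists (fun e => opair (h e)); split => //.
- exists (fun p => osnd p) => // p; apply: ocomp_ext => //.
  by rewrite ofst_opair -(ocomp_mid p) oloop_rngK.
- move=> e e'; rewrite ocomp_eleE !osnd_opair !ofst_opair.
  by case: eqVneq => [->|_]; rewrite ?ele_refl /= ?orbF.
Qed.

Lemma comp_odiag S (F : oedge S (V k)) : oiso (ocomp F (odiag V k k)) F.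
Proof.
have h (e : F) : rng F e = src _ (oloop (rng F e)) by [].
apply: oiso_sym; exists (fun e => opair (h e)); split => //.
- exists (fun p => ofst p) => // p; apply: ocomp_ext => //.
  by rewrite osnd_opair (ocomp_mid p) oloop_srcK.
- move=> e e'; rewrite ocomp_eleE !osnd_opair !ofst_opair /= /odiag_le andNb /=.
  have [le|nle] := boolP (ele F e e'); last by rewrite andbF.
  have -> : rng F e = rng F e' by apply/ele_comparable; rewrite le.
  by rewrite eqxx.
Qed.

End DiagonalUnit.

Lemma span_cat B k l m : (k <= l)%N -> (l <= m)%N ->
  oiso (ocomp (span B k l) (span B l m)) (span B k m).
Proof.
move=> kl; elim: m => [|m IH] lm.
  by move: lm kl; rewrite leqn0 => /eqP->; rewrite leqn0 => /eqP->; exact: odiag_comp.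
move: lm; rewrite leq_eqVlt => /orP[/eqP <-|].
  by rewrite span_id; exact: comp_odiag.
rewrite ltnS => lm; rewrite !spanS //; last exact: leq_trans lm.
apply: oiso_trans (ocompA _ _ _) _.
by apply: ocomp_congr (oiso_refl _); exact: IH.
Qed.

Record premor (B C : obd) := Premor {
  pidx : nat -> nat;
  pedge : forall n, oedge (vert B n) (vert C (pidx n));
  pidx0 : pidx 0 = 0%N;
  pidx_homo : forall n, (pidx n <= pidx n.+1)%N;
  pidx_unbounded : forall N, exists n, (N < pidx n)%N;
  pedge_gt0 : forall n, (0 < #|pedge n|)%N;
  pedge_src : forall n (v : vert B n), exists e, src (pedge n) e = v;
  pedge_rng : forall n (w : vert C (pidx n)), exists e, rng (pedge n) e = w;
  pedge0 : #|pedge 0| = 1%N;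
  pedge_square : forall n,
    oiso (ocomp (bedge B n) (pedge n.+1))
         (ocomp (pedge n) (span C (pidx n) (pidx n.+1)))
}.

Lemma pidx_leq B C (f : premor B C) m n : (m <= n)%N -> (pidx f m <= pidx f n)%N.
Proof.
move=> /subnK <-; elim: (n - m)%N => //= d IH.
by rewrite addSn; exact: leq_trans IH (pidx_homo f _).
Qed.

Lemma premor_span B C (f : premor B C) k l : (k <= l)%N ->
  oiso (ocomp (span B k l) (pedge f l))
       (ocomp (pedge f k) (span C (pidx f k) (pidx f l))).
Proof.
have base m : oiso (ocomp (span B m m) (pedge f m))
    (ocomp (pedge f m) (span C (pidx f m) (pidx f m))).
  by rewrite !span_id; apply: oiso_trans (odiag_comp _) (oiso_sym (comp_odiag _)).
elim: l => [|l IH]; first by rewrite leqn0 => /eqP->; exact: base.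
rewrite leq_eqVlt => /orP[/eqP <-|]; first exact: base.
rewrite ltnS => kl; rewrite spanS //.
apply: oiso_trans (oiso_sym (ocompA _ _ _)) _.
apply: oiso_trans (ocomp_congr (oiso_refl _) (pedge_square f l)) _.
apply: oiso_trans (ocompA _ _ _) _.
apply: oiso_trans (ocomp_congr (IH kl) (oiso_refl _)) _.
apply: oiso_trans (oiso_sym (ocompA _ _ _)) _.
apply: ocomp_congr (oiso_refl _) _.
by apply: span_cat; [exact: pidx_leq | exact: pidx_homo].
Qed.

Section Identity.
Variable B : obd.
Let F n : oedge (vert B n) (vert B (id n)) := odiag (vert B) n n.

Fact premor_id_src n (v : vert B n) : exists e, src (F n) e = v.
Proof. by exists (oloop v). Qed.

Fact premor_id_rng n (v : vert B n) : exists e, rng (F n) e = v.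
Proof. by exists (oloop v). Qed.

Fact premor_id_gt0 n : (0 < #|F n|)%N.
Proof.
have /card_gt0P[v _] := vert_gt0 B n.
by have [e _] := premor_id_src v; apply/card_gt0P; exists e.
Qed.

Fact premor_id_card0 : #|F 0| = 1%N.
Proof.
apply/eqP; rewrite eqn_leq premor_id_gt0 andbT.
apply/card_le1_eqP => d d' _ _; rewrite -[d]oloop_srcK -[d']oloop_srcK.
have /card_le1_eqP V0 : (#|vert B 0| <= 1)%N by rewrite vert0.
by congr oloop; exact: V0.
Qed.

Fact premor_id_square n :
  oiso (ocomp (bedge B n) (F n.+1)) (ocomp (F n) (span B n n.+1)).
Proof.
apply: oiso_trans (comp_odiag _) _; apply: oiso_trans (oiso_sym (odiag_comp _)).
by rewrite spanS // span_id; exact: oiso_sym (odiag_comp _).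
Qed.

Definition premor_id : premor B B :=
  @Premor B B id F erefl leqnSn (fun N => ex_intro _ N.+1 (leqnn N.+1))
    premor_id_gt0 premor_id_src premor_id_rng premor_id_card0 premor_id_square.

End Identity.

Section PremorComp.
Variables (B C D : obd) (f : premor B C) (g : premor C D).
Let h n := pidx g (pidx f n).
Let H n : oedge (vert B n) (vert D (h n)) := ocomp (pedge f n) (pedge g (pidx f n)).

Fact premor_comp_idx0 : h 0 = 0%N.
Proof. by rewrite /h !pidx0. Qed.

Fact premor_comp_homo n : (h n <= h n.+1)%N.
Proof. exact/pidx_leq/pidx_homo. Qed.

Fact premor_comp_unbounded N : exists n, (N < h n)%N.
Proof.
have [m Nm] := pidx_unbounded g N; have [n mn] := pidx_unbounded f m.
by exists n; apply: leq_trans Nm _; exact/pidx_leq/ltnW.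
Qed.

Fact premor_comp_src n (v : vert B n) : exists e, src (H n) e = v.
Proof.
have [e <-] := pedge_src f v; have [e' e'E] := pedge_src g (rng _ e).
by exists (opair (esym e'E)).
Qed.

Fact premor_comp_rng n (w : vert D (h n)) : exists e, rng (H n) e = w.
Proof.
have [e' <-] := pedge_rng w; have [e eE] := pedge_rng (src _ e').
by exists (opair eE).
Qed.

Fact premor_comp_gt0 n : (0 < #|H n|)%N.
Proof.
have /card_gt0P[v _] := vert_gt0 B n.
by have [e _] := premor_comp_src v; apply/card_gt0P; exists e.
Qed.

Fact premor_comp_card0 : #|H 0| = 1%N.
Proof.
apply/eqP; rewrite eqn_leq premor_comp_gt0 andbT.
apply/card_le1_eqP => p q _ _.
have /card_le1_eqP F0 : (#|pedge f 0| <= 1)%N by rewrite pedge0.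
have /card_le1_eqP G0 : (#|pedge g (pidx f 0)| <= 1)%N by rewrite pidx0 pedge0.
by apply: ocomp_ext; [exact: F0 | exact: G0].
Qed.

Fact premor_comp_square n :
  oiso (ocomp (bedge B n) (H n.+1)) (ocomp (H n) (span D (h n) (h n.+1))).
Proof.
apply: oiso_trans (ocompA _ _ _) _.
apply: oiso_trans (ocomp_congr (pedge_square f n) (oiso_refl _)) _.
apply: oiso_trans (oiso_sym (ocompA _ _ _)) _.
apply: oiso_trans (ocompA _ _ _).
by apply: ocomp_congr (oiso_refl _) (premor_span _ _); exact: pidx_homo.
Qed.

(* [premor_comp f g] is the composite gf. *)
Definition premor_comp : premor B D :=
  @Premor B D h H premor_comp_idx0 premor_comp_homo premor_comp_unbounded
    premor_comp_gt0 premor_comp_src premor_comp_rng premor_comp_card0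
    premor_comp_square.

End PremorComp.

(* The sequences n_1 < m_1 < n_2 < ... are indexed from 0 here. *)
Definition premor_equiv (B C : obd) (f g : premor B C) : Prop :=
  exists n m : nat -> nat,
    [/\ (0 < n 0)%N,
        forall k, (n k < m k < n k.+1)%N,
        forall k, (pidx f (n k) < pidx g (m k) < pidx f (n k.+1))%N,
        forall k, oiso (ocomp (span B (n k) (m k)) (pedge g (m k)))
                       (ocomp (pedge f (n k))
                              (span C (pidx f (n k)) (pidx g (m k)))) &
        forall k, oiso (ocomp (span B (m k) (n k.+1)) (pedge f (n k.+1)))
                       (ocomp (pedge g (m k))
                              (span C (pidx g (m k)) (pidx f (n k.+1))))].

(* Morphisms of OBD are the classes [f], composed by [g][f] = [gf]; the
   identity of B is the class of [premor_id B], and an isomorphism is a class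
   with a two-sided inverse. *)
Definition premor_class (B C : obd) (f : premor B C) : premor B C -> Prop :=
  fun g => premor_equiv f g.

Definition obd_iso (B C : obd) : Prop :=
  exists (f : premor B C) (g : premor C B),
    premor_class (premor_comp f g) = premor_class (premor_id B) /\
    premor_class (premor_comp g f) = premor_class (premor_id C).

(* The values of the metric lie in an arbitrary model R of the reals. *)
Definition metrizable (R : realType) (X : topologicalType) : Prop :=
  exists d : X -> X -> R,
    [/\ forall x y, (0 <= d x y)%R,
        forall x y, d x y = 0%R <-> x = y,
        forall x y, d x y = d y x,
        forall x y z, (d x z <= d x y + d y z)%R &
        forall x (A : set X), nbhs x A <->
          exists2 e : R, (0 < e)%R & [set y | (d x y < e)%R] `<=` A].

Definition homeomorphism (X : topologicalType) (phi : X -> X) : Prop :=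
  continuous phi /\
  exists psi : X -> X, [/\ cancel phi psi, cancel psi phi & continuous psi].

Definition closed_invariant (X : topologicalType) (phi : X -> X) (M : set X) :=
  [/\ M !=set0, closed M & phi @` M = M].

Definition minimal_subset (X : topologicalType) (phi : X -> X) (M : set X) :=
  closed_invariant phi M /\
  forall N, closed_invariant phi N -> N `<=` M -> N = M.

Definition essentially_minimal (R : realType) (X : topologicalType)
    (phi : X -> X) (x0 : X) : Prop :=
  [/\ metrizable R X, compact [set: X], totally_disconnected [set: X],
      homeomorphism phi &
      exists M : set X, [/\ minimal_subset phi M,
        forall M', minimal_subset phi M' -> M' = M & M x0]].

(* The towers are indexed by a finite type; since the cells are non-empty and
   pairwise disjoint, indices and towers correspond bijectively. The cells of
   the tower k are [kcell k j] for j < [height k], so indices j start at 0 and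
   values of [kcell k] at j >= [height k] are irrelevant. *)
Record kr_partition (X : topologicalType) (phi : X -> X) (x0 : X) := KR {
  tower : finType;
  height : tower -> nat;
  kcell : tower -> nat -> set X;
  height_gt0 : forall k, (0 < height k)%N;
  kcell_clopen : forall k j, (j < height k)%N -> clopen (kcell k j);
  kcell_neq0 : forall k j, (j < height k)%N -> kcell k j !=set0;
  kcell_disjoint : forall k j k' j', (j < height k)%N -> (j' < height k')%N ->
    kcell k j `&` kcell k' j' !=set0 -> k = k' /\ j = j';
  kcell_cover : forall x, exists k j, (j < height k)%N /\ kcell k j x;
  kcell_step : forall k j, (j.+1 < height k)%N ->
    phi @` kcell k j = kcell k j.+1;
  kcell_top_x0 : exists k, kcell k (height k).-1 x0;
  kcell_top_bottom :
    phi @` (\bigcup_k kcell k (height k).-1) = \bigcup_k kcell k 0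
}.

Section KakutaniRokhlin.
Variables (X : topologicalType) (phi : X -> X) (x0 : X).
Implicit Types P Q : kr_partition phi x0.

Definition ktop P : set X := \bigcup_(k : tower P) kcell k (height k).-1.

Definition kcells P : set (set X) :=
  [set A | exists (k : tower P) j, (j < height k)%N /\ A = kcell k j].

Definition krefines P Q : Prop :=
  forall A, kcells Q A -> exists2 C, kcells P C & A `<=` C.

(* A triple (S, T, k) is encoded as (S, (T, k)); the condition forces k to be
   less than the height of T, since S has positive height. With cells counted
   from 0, Y_(k+j) is included in Z_j for j < height S. *)
Definition kedge_cond P Q (e : tower P * {T : tower Q & 'I_(height T)}) : Prop :=
  let S := e.1 in let T := tag e.2 in let k := tagged e.2 in
  (k + height S <= height T)%N /\
  forall j, (j < height S)%N -> kcell T (k + j) `<=` kcell S j.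

Definition kedge P Q : Type :=
  {e : tower P * {T : tower Q & 'I_(height T)} | `[< kedge_cond e >]}.
HB.instance Definition _ P Q := Finite.on (kedge P Q).

Definition kedge_src P Q (e : kedge P Q) : tower P := (val e).1.
Definition kedge_rng P Q (e : kedge P Q) : tower Q := tag (val e).2.
Definition kedge_off P Q (e : kedge P Q) : nat := tagged (val e).2.

Definition kedge_le P Q (e e' : kedge P Q) : bool :=
  (kedge_rng e == kedge_rng e') && (kedge_off e <= kedge_off e')%N.

Fact kedge_le_refl P Q : reflexive (@kedge_le P Q).
Proof. by move=> e; rewrite /kedge_le eqxx leqnn. Qed.

Fact kedge_le_anti P Q : antisymmetric (@kedge_le P Q).
Proof.
case=> [[S [T k]] /= h] [[S' [T' k']] /= h'].
rewrite /kedge_le /kedge_rng /kedge_off /= => /andP[/andP[/eqP TT kk] /andP[_ kk']].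
subst T'; have ? : k = k' by apply/val_inj/eqP; rewrite eqn_leq kk kk'.
subst k'; apply: val_inj => /=; congr pair.
have [/= _ /(_ 0%N (height_gt0 S))] := asboolW h.
have [/= _ /(_ 0%N (height_gt0 S'))] := asboolW h'.
rewrite addn0 => s' s.
have [x kx] := kcell_neq0 (ltn_ord k).
have [] // := @kcell_disjoint _ _ _ P S 0 S' 0 (height_gt0 S) (height_gt0 S').
by exists x; split; [exact: s|exact: s'].
Qed.

Fact kedge_le_trans P Q : transitive (@kedge_le P Q).
Proof.
move=> e e1 e2 /andP[/eqP h1 l1] /andP[/eqP h2 l2]; apply/andP; split.
  by rewrite h1 h2.
exact: leq_trans l1 l2.
Qed.

Fact kedge_le_comparable P Q (e e' : kedge P Q) :
  (kedge_le e e' || kedge_le e' e) <-> kedge_rng e = kedge_rng e'.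
Proof.
rewrite /kedge_le; split => [/orP[] /andP[/eqP->]//|->].
by rewrite eqxx /=; exact: leq_total.
Qed.

Definition kedges P Q : oedge (tower P) (tower Q) :=
  @OEdge (tower P) (tower Q) (kedge P Q) (@kedge_src P Q) (@kedge_rng P Q)
    (@kedge_le P Q) (@kedge_le_refl P Q) (@kedge_le_anti P Q)
    (@kedge_le_trans P Q) (@kedge_le_comparable P Q).

Lemma kcell_iter P (S : tower P) j x : (j < height S)%N -> kcell S 0 x ->
  kcell S j (iter j phi x).
Proof.
elim: j => [//|j IH] jS x0S; rewrite iterS -kcell_step //.
by exists (iter j phi x) => //; apply: IH => //; exact: ltnW.
Qed.

Lemma kedge_start P Q (S : tower P) (T : tower Q) i :
  krefines P Q -> ktop Q `<=` ktop P -> (i < height T)%N ->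
  kcell T i `<=` kcell S 0 ->
  exists e : kedges P Q, src _ e = S /\ rng _ e = T.
Proof.
move=> PQ tPQ iT iS.
have sub j : (i + j < height T)%N -> (j < height S)%N ->
    kcell T (i + j) `<=` kcell S j.
  elim: j => [|j IH]; first by rewrite addn0.
  rewrite addnS => ijT jS; rewrite -!kcell_step //.
  by apply: image_subset; apply: IH; exact: ltnW.
have le : (i + height S <= height T)%N.
  rewrite leqNgt; apply/negP => lt.
  pose j := (height T - i).-1.
  have ijE : (i + j)%N = (height T).-1.
    by rewrite /j -subn1 addnBA ?subn_gt0// subnKC ?subn1// ltnW.
  have jS : (j.+1 < height S)%N.
    by rewrite /j prednK ?subn_gt0// ltn_subLR// ltnW.
  have ijT : (i + j < height T)%N by rewrite ijE prednK// height_gt0.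
  have [x xT] := kcell_neq0 ijT.
  have [|S' _ xS'] := tPQ x; first by exists T => //; rewrite -ijE.
  have xS := sub _ ijT (ltnW jS) _ xT.
  have h' : ((height S').-1 < height S')%N by rewrite prednK// height_gt0.
  have [|E jE] := @kcell_disjoint _ _ _ P S j S' (height S').-1 (ltnW jS) h'.
    by exists x.
  by subst S'; move: jS; rewrite jE prednK ?ltnn// height_gt0.
have c : kedge_cond (S, Tagged (fun T : tower Q => 'I_(height T)) (Ordinal iT)).
  split => //= j jS; apply: sub => //.
  by apply: leq_trans le; rewrite ltn_add2l.
by exists (exist (fun e => `[< kedge_cond e >]) _ (asboolT c) : kedge P Q).
Qed.

Lemma kedges_src_surj P Q : krefines P Q -> ktop Q `<=` ktop P ->
  forall S : tower P, exists e, src (kedges P Q) e = S.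
Proof.
move=> PQ tPQ S; have [x xS] := kcell_neq0 (height_gt0 S).
have [T [i [iT xT]]] := kcell_cover Q x.
have [|C [S' [j [jS' ->]]] sub] := PQ (kcell T i); first by exists T, i.
have [|? ?] := @kcell_disjoint _ _ _ P S 0 S' j (height_gt0 S) jS'.
  by exists x; split => //; exact: sub.
subst S' j; have [e [eS _]] := kedge_start PQ tPQ iT sub.
by exists e.
Qed.

Lemma kedges_rng_surj P Q : krefines P Q -> ktop Q `<=` ktop P ->
  forall T : tower Q, exists e, rng (kedges P Q) e = T.
Proof.
move=> PQ tPQ T; have [x xT] := kcell_neq0 (height_gt0 T).
have : (\bigcup_(k : tower Q) kcell k 0) x by exists T.
rewrite -kcell_top_bottom => -[y /tPQ yP yx].
have : (\bigcup_(k : tower P) kcell k 0) x.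
  by rewrite -kcell_top_bottom; exists y.
move=> [S _ xS].
have [|C [S' [j [jS' ->]]] sub] := PQ (kcell T 0).
  by exists T, 0%N; split => //; exact: height_gt0.
have [|? ?] := @kcell_disjoint _ _ _ P S 0 S' j (height_gt0 S) jS'.
  by exists x; split => //; exact: sub.
subst S' j; have [e [_ eT]] := kedge_start PQ tPQ (height_gt0 T) sub.
by exists e.
Qed.

End KakutaniRokhlin.

Record sds (R : realType) := SDS {
  space : topologicalType;
  homeo : space -> space;
  base : space;
  sds_essmin : essentially_minimal R homeo base;
  krp : nat -> kr_partition homeo base;
  krp0 : kcells (krp 0) = [set [set: space]];
  krp_refines : forall n, krefines (krp n) (krp n.+1);
  krp_top_decr : forall n, (0 < n)%N -> ktop (krp n.+1) `<=` ktop (krp n);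
  krp_top_inter : \bigcap_(n in [set n | (0 < n)%N]) ktop (krp n) = [set base];
  krp_basis : basis (\bigcup_n kcells (krp n))
}.

Arguments krp_refines {R} s n.

Section FunctorOnObjects.
Variables (R : realType) (X : sds R).
Let P := krp X.

Fact krp0_cell (k : tower (P 0)) j : (j < height k)%N ->
  kcell k j = [set: space X].
Proof.
move=> jk; have : kcells (P 0) (kcell k j) by exists k, j.
by rewrite /P krp0.
Qed.

Fact sds_top_decr n : ktop (P n.+1) `<=` ktop (P n).
Proof.
case: n => [|n]; last exact: krp_top_decr.
move=> x _; have [k [j [jk _]]] := kcell_cover (P 0) x.
by exists k => //; rewrite krp0_cell // prednK // height_gt0.
Qed.

Fact sds_vert_gt0 n : (0 < #|tower (P n)|)%N.
Proof.
by have [k _] := kcell_cover (P n) (base X); apply/card_gt0P; exists k.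
Qed.

Fact sds_vert0 : #|tower (P 0)| = 1%N.
Proof.
apply/eqP; rewrite eqn_leq sds_vert_gt0 andbT.
apply/card_le1_eqP => k' k _ _.
have [] // := @kcell_disjoint _ _ _ (P 0) k' 0 k 0 (height_gt0 k') (height_gt0 k).
by exists (base X); rewrite !krp0_cell ?height_gt0.
Qed.

Fact sds_edge_gt0 n : (0 < #|kedges (P n) (P n.+1)|)%N.
Proof.
have /card_gt0P[S _] := sds_vert_gt0 n.
have [e _] := kedges_src_surj (krp_refines X n) (@sds_top_decr n) S.
by apply/card_gt0P; exists e.
Qed.

Definition bratteli : obd :=
  @OBD (fun n => tower (P n)) (fun n => kedges (P n) (P n.+1))
    sds_vert0 sds_vert_gt0 sds_edge_gt0
    (fun n => kedges_src_surj (krp_refines X n) (@sds_top_decr n))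
    (fun n => kedges_rng_surj (krp_refines X n) (@sds_top_decr n)).

End FunctorOnObjects.

(* Main.v *)
Require Import Defs.
From HB Require Import structures.
From mathcomp Require Import all_boot all_order ssralg ssrnum archimedean.
From mathcomp Require Import all_classical reals topology.

(** Both directions rest on a finite reformulation of proper ordering. Treat
    maximal and minimal edges together, as the two kinds of extremal edges
    (a boolean b chooses between them). An extremal edge of a composite F o G is
    a pair of extremal edges, so in a span E_(n,N) there is exactly one extremal
    path ending at each vertex of V_N, and following it downwards is a map
    V_N -> V_n. The diagram is called contracting when, for each n, this map is
    constant for some N (predicates [same_src] and [contracting]). A contracting
    diagram has exactly one extremal infinite path: the constant values are the
    vertices through which it must go ([contracting_path]).

    Necessity. The diagram of a system of Kakutani-Rokhlin partitions is
    contracting: following maximal edges from level N to level n finds the tower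
    of P_n whose top contains the top of a given tower of P_N, and the tops
    shrink to the base point, so by compactness all of the top of P_N ends up in
    the one top cell of P_n around that point. For minimal edges the same holds
    with bottoms and the image of the base point ([contracting_bratteli]). Being
    contracting passes to any B that is a retract of a contracting C: the
    equivalence of gf and the identity factors a span of B through a span of C,
    and a composite is constant as soon as one of its factors is
    ([contracting_retract]).

    Sufficiency is the Bratteli-Vershik construction. Write h(v) for the number
    of paths from the root to v. The edges into a vertex being linearly ordered,
    so are the paths from the root to it, and an infinite path x has at level n a
    vertex v and a position j < h(v), the rank of its initial segment. The
    position increases by an offset along each edge, so positions can be handled
    arithmetically as sums of mixed-radix digits. The pair (v, j) determines the
    first n edges, hence the sets of paths with given vertex and position at
    level n are the cells of a partition with towers indexed by V_n. The Vershik
    map is described level by level: y comes after x when, at each level, either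
    y has the vertex of x and the next position, or x is at the top of its tower
    and y at the bottom of some tower ([next]). This condition is inherited by
    lower levels, and it is the graph of a bijection because the
    maximal and the minimal path are unique ([next_total], [prev_total]). As a
    decreasing intersection of clopen relations on a compact space it is the
    graph of a homeomorphism ([graph_continuous]). Each orbit climbs to the top
    of its tower at every level, and the tops shrink to the maximal path, so this
    path belongs to every closed invariant set; this gives essential minimality.
    Finally an edge e into w corresponds to the crossing of the tower of w that
    starts at the offset of e, which identifies the diagram of the partitions
    with B ([path_kedges]). *)

Set Implicit Arguments.
Unset Strict Implicit.
Unset Printing Implicit Defensive.

Import Order.TTheory GRing.Theory Num.Theory.

Local Open Scope classical_set_scope.

(** * Extremal edges and contracting diagrams *)

(** [b = true] selects maximal edges and [b = false] minimal ones; every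
    statement about both ends of an order is proved once, for all b. *)
Definition extremal (b : bool) S T (F : oedge S T) (e : F) : Prop :=
  forall e', (if b then ele F e e' else ele F e' e) -> e' = e.

Definition rng_onto S T (F : oedge S T) : Prop :=
  forall t, exists e, rng F e = t.

Definition same_src (b : bool) S T (F : oedge S T) : Prop :=
  forall e e' : F, extremal b e -> extremal b e' -> src F e = src F e'.

Lemma extremal_uniq b S T (F : oedge S T) (e e' : F) :
  extremal b e -> extremal b e' -> rng F e = rng F e' -> e = e'.
Proof.
case: b => h h' /ele_comparable/orP[] l.
- by rewrite (h e').
- by rewrite -(h' e).
- by rewrite -(h' e).
- by rewrite (h e').
Qed.

(** A finite set of edges with a common range is a chain, so it contains an
    extremal element. *)
Lemma exists_extremal_in b S T (F : oedge S T) (P : pred F) (e0 : F) :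
  P e0 -> (forall e e', P e -> P e' -> rng F e = rng F e') ->
  exists2 e, P e & forall e', P e' -> if b then ele F e' e else ele F e e'.
Proof.
move=> Pe0 Pr.
pose le (e e' : F) := if b then ele F e' e else ele F e e'.
(* The extremal element is the one that dominates the most elements of P. *)
pose m e := #|[pred e' | P e' && le e e']|.
case: (arg_maxnP m Pe0) => e Pe emax; exists e => // e' Pe'.
have /orP [//|lee'] : le e e' || le e' e.
  rewrite /le; case: (b); rewrite ?[X in X || _]orbC; first by rewrite orbC;
    apply/ele_comparable/Pr.
  exact/ele_comparable/Pr.
have : [pred x | P x && le e x] \subset [pred x | P x && le e' x].
  apply/fintype.subsetP => x; rewrite !inE => /andP[-> l] /=.
  move: lee' l; rewrite /le; case: (b) => l1 l2.
    exact: ele_trans l2 l1.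
  exact: ele_trans l1 l2.
move=> sub; have := emax e' Pe'; rewrite /m => ge.
have /eqP E : #|[pred x | P x && le e x]| == #|[pred x | P x && le e' x]|.
  by rewrite eqn_leq subset_leq_card //=.
have := subset_cardP E sub e'; rewrite !inE Pe' /= => lee.
by rewrite -/(le e e') lee /le; case: (b); rewrite ele_refl.
Qed.

Lemma exists_extremal b S T (F : oedge S T) (e0 : F) :
  exists2 e, extremal b e & rng F e = rng F e0.
Proof.
have [|e /asboolP er emax] := @exists_extremal_in b S T F
    (fun e => `[< rng F e = rng F e0 >]) e0 (asboolT erefl).
  by move=> e e' /asboolP-> /asboolP->.
exists e => // e' l; apply: (@ele_anti _ _ F).
have r : `[< rng F e' = rng F e0 >].
  apply/asboolP; rewrite -er; apply/ele_comparable.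
  by case: (b) l => ->; rewrite ?orbT.
by have := emax _ r; case: (b) l => -> ->.
Qed.

(** The order of a composite compares second components first. Surjectivity of
    the range of F allows a second component that is not extremal to be improved:
    the better one still has some first component before it. *)
Lemma extremal_ocomp b S T U (F : oedge S T) (G : oedge T U) (p : ocomp F G) :
  rng_onto F -> extremal b p <-> extremal b (ofst p) /\ extremal b (osnd p).
Proof.
move=> oF; split=> [h|[h1 h2] q].
  split=> e' l.
    have er : rng F e' = src G (osnd p).
      rewrite -ocomp_mid; apply/ele_comparable.
      by case: (b) l => ->; rewrite ?orbT.
    rewrite -(ofst_opair er); congr ofst; apply: h.
    by rewrite !ocomp_eleE osnd_opair ofst_opair eqxx /=.
  have [//|ne] := eqVneq e' (osnd p); have [e er] := oF (src G e').
  rewrite -(osnd_opair er); congr osnd; apply: h.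
  rewrite !ocomp_eleE osnd_opair ofst_opair [osnd p == _]eq_sym ne.
  by case: (b) l => ->.
rewrite !ocomp_eleE => l.
have E : osnd q = osnd p.
  apply: h2; case: (b) l => /orP[] /andP[] // /eqP->; by rewrite ele_refl.
apply: ocomp_ext => //; apply: h1.
by case: (b) l; rewrite E eqxx.
Qed.

Lemma extremal_morph b S T (F F' : oedge S T) (f : F -> F') e : bijective f ->
  (forall e1 e2, ele F' (f e1) (f e2) = ele F e1 e2) ->
  extremal b e -> extremal b (f e).
Proof.
move=> [g fg gf] fl he e' l; rewrite -[e']gf; congr f; apply: he.
by move: l; rewrite -[ele F _ e]fl -[ele F e _]fl gf.
Qed.

(** Isomorphic edge sets have the same extremal edges up to relabelling, which
    makes [same_src] usable modulo the isomorphisms that define morphisms. *)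
Lemma same_src_oiso b S T (F F' : oedge S T) : oiso F F' ->
  same_src b F -> same_src b F'.
Proof.
move=> /oiso_sym[f [bf fs _ fl]] h e e' /(extremal_morph bf fl) he.
by move=> /(extremal_morph bf fl) he'; rewrite -!fs; exact: h.
Qed.

Lemma same_src_ocompl b S T U (F : oedge S T) (G : oedge T U) :
  rng_onto F -> same_src b F -> same_src b (ocomp F G).
Proof.
by move=> oF h p q /(extremal_ocomp _ _ oF)[p1 _] /(extremal_ocomp _ _ oF)[q1 _]; exact: h.
Qed.

(** The second components have the same source, so the first components are
    extremal edges with the same range, and these are unique. *)
Lemma same_src_ocompr b S T U (F : oedge S T) (G : oedge T U) :
  rng_onto F -> same_src b G -> same_src b (ocomp F G).
Proof.
move=> oF h p q /(extremal_ocomp _ _ oF)[p1 p2] /(extremal_ocomp _ _ oF)[q1 q2].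
apply: (congr1 (src F)); apply: extremal_uniq p1 q1 _.
by rewrite !ocomp_mid; exact: h.
Qed.

Lemma rng_onto_span B k l : (k <= l)%N -> rng_onto (span B k l).
Proof.
elim: l => [|l IH]; first by rewrite leqn0 => /eqP-> t; exists (oloop t).
rewrite leq_eqVlt => /orP[/eqP->|kl t]; first by rewrite span_id => t; exists (oloop t).
have [e er] := rng_surj t; have [e' er'] := IH kl (src _ e).
by rewrite spanS //; exists (opair er').
Qed.

(** Uniqueness of the infinite extremal path, expressed through the spans, as
    these are what a premorphism relates. *)
Definition contracting b (B : obd) : Prop :=
  forall n, exists2 N, (n <= N)%N & same_src b (span B n N).

Lemma same_src_span b B k n N : (k <= n)%N -> (n <= N)%N ->
  same_src b (span B n N) -> same_src b (span B k N).
Proof.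
move=> kn nN h; apply: same_src_oiso (span_cat B kn nN) _.
by apply: same_src_ocompr h; exact: rng_onto_span.
Qed.

Lemma same_src_span_widen b B n N M : (n <= N)%N -> (N <= M)%N ->
  same_src b (span B n N) -> same_src b (span B n M).
Proof.
move=> nN NM h; apply: same_src_oiso (span_cat B nN NM) _.
by apply: same_src_ocompl h; exact: rng_onto_span.
Qed.

(** Put a = n_k, c = m_k, i = f_a and j = g_i. The equivalence factors E_(a,c) as
    F_a o G_i o E_(j,c). Prolonged up to level g_K of B, it contains the factor
    G_i o E_(j,g_K), which is S_(i,K) o G_K as g is a premorphism; and extremal
    edges of S_(i,K) have a common source for large K. *)
Lemma contracting_retract b B C (f : premor B C) (g : premor C B) :
  premor_equiv (premor_comp f g) (premor_id B) ->
  contracting b C -> contracting b B.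
Proof.
case=> n [m [_ nm fm eq1 _]] cC k.
have nk j : (j <= n j)%N.
  elim: j => // j IH; apply: leq_ltn_trans IH _.
  by have /andP[h1 h2] := nm j; exact: ltn_trans h1 h2.
have /andP[/ltnW nm1 _] := nm k; have /andP[/ltnW fm1 _] := fm k.
pose a := n k; pose c := m k.
have [M aM hM] := cC (pidx f a).
have [L cL] := pidx_unbounded g c.
pose K := maxn M L.
have aK : (pidx f a <= K)%N by exact: leq_trans aM (leq_maxl _ _).
have cK : (c <= pidx g K)%N.
  by apply: leq_trans (ltnW cL) _; apply: pidx_leq; exact: leq_maxr.
have hC : same_src b (span C (pidx f a) K).
  by apply: same_src_span_widen hM => //; exact: leq_maxl.
exists (pidx g K); first by apply: leq_trans (nk k) _; exact: leq_trans nm1 cK.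
apply: (same_src_span (nk k) (leq_trans nm1 cK)).
apply: same_src_oiso (span_cat B nm1 cK) _.
apply: same_src_oiso (ocomp_congr (comp_odiag _) (oiso_refl _)) _.
apply: same_src_oiso (ocomp_congr (oiso_sym (eq1 k)) (oiso_refl _)) _.
apply: same_src_oiso (ocompA _ _ _) _.
apply: same_src_oiso (ocomp_congr (oiso_refl _) (oiso_sym (span_cat B fm1 cK))) _.
apply: same_src_oiso (ocompA _ _ _) _.
apply: same_src_ocompr; first by move=> w; exact: pedge_rng.
apply: same_src_oiso (premor_span g aK) _.
by apply: same_src_ocompl hC; exact: rng_onto_span.
Qed.

(** * Extremal paths of a contracting diagram *)

Definition extremal_path b (B : obd) (p : forall n, bedge B n) : Prop :=
  inf_path p /\ forall n, extremal b (p n).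

Lemma rng_onto_bedge (B : obd) n : rng_onto (bedge B n).
Proof. exact: rng_surj. Qed.

Lemma span_gt0 (B : obd) n N : (n <= N)%N -> (0 < #|span B n N|)%N.
Proof.
move=> nN; have /card_gt0P[v _] := vert_gt0 B N.
by have [e _] := rng_onto_span nN v; apply/card_gt0P; exists e.
Qed.

(** Composing the edges of the path between levels n and N. *)
Lemma span_extremal_path b (B : obd) p n N : extremal_path b p -> (n <= N)%N ->
  exists2 e : span B n N, extremal b e &
    src _ e = src _ (p n) /\ rng _ e = src _ (p N).
Proof.
move=> [pp pe]; elim: N => [|N IH].
  rewrite leqn0 => /eqP->; exists (oloop (src _ (p 0%N))) => // e'.
  by case: (b) => /eqP ->.
rewrite leq_eqVlt => /orP[/eqP->|nN].
  rewrite span_id; exists (oloop (src _ (p N.+1))) => // e'.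
  by case: (b) => /eqP ->.
have [e ee [es er]] := IH nN.
rewrite spanS //; exists (opair er); last by rewrite /= -pp.
by apply/extremal_ocomp => //; exact: rng_onto_span.
Qed.

(** The paths from the common source at level n to level N all follow the
    extremal edges; reading off their sources for each n gives the only
    candidate for an extremal path. *)
Lemma contracting_path b (B : obd) : contracting b B ->
  exists! p : forall n, bedge B n, extremal_path b p.
Proof.
move=> cB.
pose sv n (v : vert B n) := exists2 N, (n <= N)%N &
  forall M (e : span B n M), (N <= M)%N -> extremal b e -> src _ e = v.
have svP n : exists v, @sv n v.
  have [N nN h] := cB n.
  have /card_gt0P[e0 _] := span_gt0 B nN.
  have [e ee _] := exists_extremal b e0.
  exists (src _ e), N => // M e' NM ee'.
  have [f [bf fs _ fl]] := oiso_sym (span_cat B nN NM).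
  have : extremal b (f e').
    exact: extremal_morph.
  by case/extremal_ocomp => [|h1 _]; [exact: rng_onto_span|rewrite -fs; exact: h].
pose v n := projT1 (cid (svP n)); have vP n : sv n (v n) := projT2 (cid (svP n)).
have prevP n : exists e : bedge B n, rng _ e = v n.+1 /\ extremal b e.
  have [e0 e0r] := rng_surj (v n.+1).
  by have [e ee er] := exists_extremal b e0; exists e; rewrite er.
pose p n := projT1 (cid (prevP n)).
have pP n : rng _ (p n) = v n.+1 /\ extremal b (p n) := projT2 (cid (prevP n)).
have ps n : src _ (p n) = v n.
  have [N1 nN1 h1] := vP n; have [N2 nN2 h2] := vP n.+1.
  pose M := maxn N1 N2.
  have nM : (n.+1 <= M)%N by exact: leq_trans nN2 (leq_maxr _ _).
  have /card_gt0P[e0 _] := span_gt0 B nM.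
  have [e ee _] := exists_extremal b e0.
  have es : src _ e = v n.+1 by apply: h2 => //; exact: leq_maxr.
  (* Prolonging [p n] by an extremal path from level n.+1 gives an extremal path
     from level n, whose source is [v n]. *)
  have iso : oiso (ocomp (bedge B n) (span B n.+1 M)) (span B n M).
    apply: oiso_trans (span_cat B (leqnSn n) nM).
    apply: ocomp_congr (oiso_refl _).
    rewrite spanS // span_id; exact: oiso_sym (odiag_comp _).
  have pe : rng _ (p n) = src _ e by rewrite es; case: (pP n).
  have xe : extremal b (opair pe).
    apply/extremal_ocomp; first exact: rng_onto_bedge.
    by split; [case: (pP n)|].
  have [f [bf fs _ fl]] := iso.
  rewrite -[LHS]/(src _ (opair pe)) -fs; apply: h1; first exact: leq_maxl.
  exact: extremal_morph.
exists p; split.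
  split=> [n|n]; last by case: (pP n).
  by rewrite ps; case: (pP n).
move=> q qP; apply: functional_extensionality_dep => n.
have qs m : src _ (q m) = v m.
  have [N mN h] := vP m; have [e ee [<- _]] := span_extremal_path qP mN.
  exact: h.
have [pr pe] := pP n; have [qp qe] := qP.
by apply: extremal_uniq pe (qe n) _; rewrite pr qp qs.
Qed.

(** * Diagrams of Kakutani-Rokhlin partitions are contracting *)

(** Points of U_n outside O would accumulate at a point of all the U_n that is
    not in O. *)
Lemma compact_shrink (X : topologicalType) (U : nat -> set X) (O : set X) :
  compact [set: X] -> (forall n, closed (U n)) -> (forall n, U n.+1 `<=` U n) ->
  open O -> \bigcap_n U n `<=` O -> exists n, U n `<=` O.
Proof.
move=> cX cU dU oO UO; apply: contrapT => nsub.
have dec m n : (m <= n)%N -> U n `<=` U m.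
  by move=> /subnK <-; elim: (n - m)%N => // d IH x /dU /IH.
have xP n : exists x, U n x /\ ~ O x.
  apply: contrapT => h; apply: nsub; exists n => x Ux; apply: contrapT => nO.
  by apply: h; exists x.
have [x {}xP] := choice xP.
have [p [_ cp]] := cX (x @ \oo) _ filterT.
have clos (A : set X) N : closed A -> (forall n, (N <= n)%N -> A (x n)) -> A p.
  move=> cA h; apply: cA => V Vp; apply: cp Vp.
  by exists N => //= n /= Nn; exact: h.
have : (~` O) p by apply: (@clos _ 0%N) => [|n _]; [exact: open_closedC|exact: (xP n).2].
apply; apply: UO => n _; apply: (@clos _ n) => // m nm; exact: dec nm _ (xP m).1.
Qed.

Section KREdges.
Variables (X : topologicalType) (phi : X -> X) (x0 : X).
Implicit Types P Q : kr_partition phi x0.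

Lemma top_lt P (S : tower P) : ((height S).-1 < height S)%N.
Proof. by rewrite prednK // height_gt0. Qed.

Lemma kcell_uniq P (S S' : tower P) j j' x : (j < height S)%N ->
  (j' < height S')%N -> kcell S j x -> kcell S' j' x -> S = S' /\ j = j'.
Proof. by move=> h h' c c'; apply: kcell_disjoint => //; exists x. Qed.

Lemma kcell_shift P (S : tower P) i j : (i + j < height S)%N ->
  iter j (image^~ phi) (kcell S i) = kcell S (i + j).
Proof.
elim: j => [|j IH]; first by rewrite addn0.
by rewrite addnS => ij; rewrite /= IH ?kcell_step //; exact: ltnW.
Qed.

(** A cell of T inside a bottom cell S 0 climbs through S together with it, and
    T cannot end before S does, as tops of Q lie in tops of P. *)
Lemma kedge_at P Q (S : tower P) (T : tower Q) i :
  ktop Q `<=` ktop P -> (i < height T)%N -> kcell T i `<=` kcell S 0 ->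
  exists e : kedges P Q, [/\ src _ e = S, rng _ e = T & kedge_off e = i].
Proof.
move=> tPQ iT iS.
have sub j : (i + j < height T)%N -> (j < height S)%N ->
    kcell T (i + j) `<=` kcell S j.
  move=> ij jS; rewrite -(kcell_shift ij) -[j in kcell S j]add0n -kcell_shift //.
  by elim: j {ij jS} => //= j IH; exact: image_subset.
have le : (i + height S <= height T)%N.
  rewrite leqNgt; apply/negP => lt.
  (* At step j, T is at its top, but S is not. *)
  pose j := ((height T).-1 - i)%N.
  have ijE : (i + j)%N = (height T).-1 by rewrite subnKC // -ltnS prednK // height_gt0.
  have jS : (j.+1 < height S)%N.
    by rewrite -(ltn_add2l i) addnS ijE prednK // height_gt0.
  have ijT : (i + j < height T)%N by rewrite ijE top_lt.
  have [x xT] := kcell_neq0 ijT.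
  have [|S' _ xS'] := tPQ x; first by exists T => //; rewrite -ijE.
  have [E jE] := kcell_uniq (ltnW jS) (top_lt S') (sub _ ijT (ltnW jS) _ xT) xS'.
  by move: jS; rewrite jE -E prednK ?ltnn // height_gt0.
have c : kedge_cond (S, Tagged (fun T : tower Q => 'I_(height T)) (Ordinal iT)).
  by split => //= j jS; apply: sub => //; apply: leq_trans le; rewrite ltn_add2l.
by exists (exist (fun e => `[< kedge_cond e >]) _ (asboolT c) : kedge P Q).
Qed.

Lemma kcell_sub P Q (S : tower P) (T : tower Q) i j x : krefines P Q ->
  (i < height T)%N -> (j < height S)%N -> kcell T i x -> kcell S j x ->
  kcell T i `<=` kcell S j.
Proof.
move=> PQ iT jS xT xS.
have [|C [S' [j' [jS' ->]]] sub] := PQ (kcell T i); first by exists T, i.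
by have [-> ->] := kcell_uniq jS jS' xS (sub _ xT).
Qed.

Lemma kedgeP P Q (e : kedges P Q) : [/\ (kedge_off e < height (rng _ e))%N,
  (kedge_off e + height (src _ e) <= height (rng _ e))%N &
  forall j, (j < height (src _ e))%N ->
    kcell (rng _ e) (kedge_off e + j) `<=` kcell (src _ e) j].
Proof. by have [le sub] := asboolW (valP e); split => //; exact: ltn_ord. Qed.

Definition end_cell b P (T : tower P) : set X :=
  if b then kcell T (height T).-1 else kcell T 0.

(** If the last tower of P crossed by T stopped below the top of T, the next
    cell of T would be in the bottom of P and give a larger edge. Dually for
    the first one. *)
Lemma extremal_kedge b P Q (e : kedges P Q) :
  krefines P Q -> ktop Q `<=` ktop P -> extremal b e ->
  end_cell b (rng _ e) `<=` end_cell b (src _ e).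
Proof.
move=> PQ tPQ xe; have [oe le sub] := kedgeP e.
set T := rng _ e in oe le sub *; set S := src _ e in le sub *.
have edge_from x i (xB : (\bigcup_(S : tower P) kcell S 0) x) :
    (i < height T)%N -> kcell T i x ->
    exists2 e' : kedges P Q, rng _ e' = T & kedge_off e' = i.
  case: xB => S' _ xS' iT xT.
  have sub' := kcell_sub PQ iT (height_gt0 S') xT xS'.
  by have [e' [_ e'r e'o]] := kedge_at tPQ iT sub'; exists e'.
case: b xe => xe; rewrite /end_cell.
  have [E|ne] := eqVneq (kedge_off e + height S)%N (height T).
    rewrite -E -subn1 -addnBA ?height_gt0 // subn1; apply: sub; exact: top_lt.
  have lt : (kedge_off e + height S < height T)%N by rewrite ltn_neqAle ne.
  have ltp : ((kedge_off e + (height S).-1).+1 < height T)%N.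
    by rewrite -addnS prednK // height_gt0.
  have [y yT] := kcell_neq0 lt.
  have [|e' e'r e'o] := @edge_from y (kedge_off e + height S)%N _ lt yT.
    rewrite -kcell_top_bottom.
    move: yT; rewrite -[height S]prednK ?height_gt0 // addnS -kcell_step //.
    move=> [z zT <-]; exists z => //; exists S => //; apply: sub zT; exact: top_lt.
  have /esym ee : e' = e.
    by apply: xe; rewrite /= /kedge_le e'o leq_addr andbT; apply/eqP; rewrite -[LHS]/T.
  by move: e'o; rewrite -ee => /eqP; rewrite -[X in X == _]addn0 eqn_add2l eq_sym
    -leqn0 leqNgt height_gt0.
have [y yT] := kcell_neq0 (height_gt0 T).
have [|e' e'r e'o] := @edge_from y 0%N _ (height_gt0 T) yT.
  have : (\bigcup_(T : tower Q) kcell T 0) y by exists T.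
  rewrite -kcell_top_bottom => -[z /tPQ zt zy].
  by rewrite -kcell_top_bottom; exists z.
have /esym ee : e' = e.
  by apply: xe; rewrite /= /kedge_le e'o andbT; apply/eqP.
have := sub 0%N (height_gt0 S).
by rewrite addn0 ee e'o.
Qed.

Lemma ktop_clopen P : clopen (ktop P).
Proof.
split; first by apply: bigcup_open => S _; exact: (kcell_clopen (top_lt S)).1.
apply: closed_bigcup => [|S _]; last exact: (kcell_clopen (top_lt S)).2.
exact: finite_finset.
Qed.

End KREdges.

(** The tops of the partitions shrink to the base point, hence eventually lie
    in a single cell; their images, the bottoms, shrink to its image. *)
Lemma contracting_bratteli (R : realType) (X : sds R) b :
  contracting b (bratteli X).
Proof.
have [_ cX _ [cphi _] _] := sds_essmin X.
have ends n N (e : span (bratteli X) n N) : (n <= N)%N -> extremal b e ->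
    @end_cell _ _ _ b (krp X N) (rng _ e) `<=` @end_cell _ _ _ b (krp X n) (src _ e).
  elim: N e => [|N IH] e.
    rewrite leqn0 => /eqP E; move: e; rewrite E => e _.
    by rewrite -(oloop_srcK e) => x.
  rewrite leq_eqVlt => /orP[/eqP E|nN].
    by move: e; rewrite E span_id => e _; rewrite -(oloop_srcK e) => x.
  move: e; rewrite spanS // => e /extremal_ocomp[|e1 e2]; first exact: rng_onto_span.
  apply: subset_trans (IH _ nN e1); rewrite ocomp_mid.
  apply: extremal_kedge => //; first exact: krp_refines.
  exact: sds_top_decr.
move=> n.
(* The tops shrink to x1 if [b], and the bottoms to x1 otherwise. *)
pose x1 := if b then base X else homeo (base X).
have [S0 x1S] : exists S : tower (krp X n), end_cell b S x1.
  rewrite /end_cell /x1; case: b ends @x1 => _.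
    by have [S] := kcell_top_x0 (krp X n); exists S.
  have [S St] := kcell_top_x0 (krp X n).
  have : (\bigcup_(S : tower (krp X n)) kcell S 0) (homeo (base X)).
    by rewrite -kcell_top_bottom; exists (base X) => //; exists S.
  by move=> [S' _ h]; exists S'.
have oS0 : open (end_cell b S0).
  rewrite /end_cell; case: (b); apply: (kcell_clopen _).1; first exact: top_lt.
  exact: height_gt0.
pose O := if b then end_cell b S0 else @homeo _ X @^-1` end_cell b S0.
have oO : open O.
  move: oS0; rewrite /O; case: (b) => // oS; apply: open_comp oS => x _.
  exact: cphi.
have [||//||k kO] := @compact_shrink _ (fun k => ktop (krp X k.+1)) O cX.
- by move=> k; exact: (ktop_clopen _).2.
- by move=> k; exact: sds_top_decr.
- move=> x xU; have : [set base X] x.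
    by rewrite -krp_top_inter => -[|k] //= _; exact: xU.
  by move=> ->; move: x1S; rewrite /O /x1; case: (b).
pose N := maxn n k.+1.
have nN : (n <= N)%N by exact: leq_maxl.
have ZN : ktop (krp X N) `<=` ktop (krp X k.+1).
  have : (k.+1 <= N)%N by exact: leq_maxr.
  move=> /subnK <-; elim: (N - k.+1)%N => // d IH x; rewrite addSn => /sds_top_decr.
  exact: IH.
exists N => //.
suff main e : extremal b e -> src (span (bratteli X) n N) e = S0.
  by move=> e e' /main-> /main->.
move=> xe; have := ends _ _ e nN xe.
set T : tower (krp X N) := rng _ e; set S : tower (krp X n) := src _ e => sub.
have TS0 : end_cell b T `<=` end_cell b S0.
  rewrite /end_cell in kO *; move: kO; rewrite /O /end_cell; case: (b) => kO x xT.
    by apply/kO/ZN; exists T.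
  have : (\bigcup_(S : tower (krp X N)) kcell S 0) x by exists T.
  by rewrite -kcell_top_bottom => -[y /ZN /kO h <-].
have [x xT] : end_cell b T !=set0.
  rewrite /end_cell; case: (b); apply: kcell_neq0; first exact: top_lt.
  exact: height_gt0.
move: {xT} (sub _ xT) (TS0 _ xT); rewrite /end_cell; case: (b) => h1 h2.
  by case: (kcell_uniq (top_lt S) (top_lt S0) h1 h2).
by case: (kcell_uniq (height_gt0 S) (height_gt0 S0) h1 h2).
Qed.

(** * Positions of paths in an ordered diagram *)

Section Offsets.
Variables (S T : finType) (F : oedge S T) (h : S -> nat).
Hypothesis h_gt0 : forall s, (0 < h s)%N.
Implicit Types e : F.

(** If h counts paths ending at each source, this is the number of paths through
    a smaller edge, that is, the rank of the first path through e among the paths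
    ending at its range. *)
Definition off e : nat := (\sum_(e' : F | ele F e' e && (e' != e)) h (src F e'))%N.

Definition fibre_sum (t : T) : nat := (\sum_(e : F | rng F e == t) h (src F e))%N.

Lemma off_endE e :
  (off e + h (src F e) = \sum_(e' : F | ele F e' e) h (src F e'))%N.
Proof. by rewrite (bigD1 e) ?ele_refl //= addnC. Qed.

Lemma sub_sum (P Q : pred F) : (forall e, P e -> Q e) ->
  (\sum_(e | P e) h (src F e) <= \sum_(e | Q e) h (src F e))%N.
Proof.
move=> PQ; rewrite big_mkcond [leqRHS]big_mkcond; apply: leq_sum => e _.
by case: ifP => // /PQ ->.
Qed.

Lemma ele_rng e e' : ele F e e' -> rng F e = rng F e'.
Proof. by move=> l; apply/ele_comparable; rewrite l. Qed.

Lemma ele_lt_neg e e' : rng F e = rng F e' -> ~~ ele F e e' -> ele F e' e && (e' != e).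
Proof.
move=> /ele_comparable/orP[->//|l] nl; rewrite l /=.
by apply: contraNneq nl => ->; rewrite ele_refl.
Qed.

Lemma off_lt e e' : ele F e e' -> e != e' -> (off e + h (src F e) <= off e')%N.
Proof.
move=> l ne; rewrite off_endE; apply: sub_sum => f fe; rewrite (ele_trans fe l) /=.
apply: contraNneq ne => E; rewrite -E in l; apply/eqP/(@ele_anti _ _ F).
by rewrite -E in fe *; rewrite l fe.
Qed.

Lemma off_le e e' : rng F e = rng F e' -> ele F e e' = (off e <= off e')%N.
Proof.
move=> r; apply/idP/idP => [l|].
  have [->//|ne] := eqVneq e e'.
  exact: leq_trans (leq_addr _ _) (off_lt l ne).
apply: contraTT => /(ele_lt_neg r)/andP[l ne].
by rewrite -ltnNge; apply: leq_trans (off_lt l ne); rewrite -addn1 leq_add2l.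
Qed.

Lemma off_end e : (off e + h (src F e) <= fibre_sum (rng F e))%N.
Proof. by rewrite off_endE; apply: sub_sum => f /ele_rng ->. Qed.

(** The intervals [off e, off e + h(src e)) with e ranging over the edges into t
    are disjoint; by [off_ex] they cover [0, fibre_sum t). *)
Lemma off_uniq e e' j : rng F e = rng F e' ->
  (off e <= j < off e + h (src F e))%N -> (off e' <= j < off e' + h (src F e'))%N ->
  e = e'.
Proof.
move=> /ele_comparable/orP lcomp /andP[a1 a2] /andP[b1 b2].
apply/eqP; apply/negP => /negP ne.
case: lcomp => l.
  by have := leq_trans a2 (off_lt l ne); rewrite ltnNge b1.
by rewrite eq_sym in ne; have := leq_trans b2 (off_lt l ne); rewrite ltnNge a1.
Qed.

(** Take the last edge e whose interval starts at or before j. If its interval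
    also ended at or before j, then the next edge would start there, or e would be
    the last edge and j would be out of range. *)
Lemma off_ex t j : (j < fibre_sum t)%N ->
  exists2 e, rng F e = t & (off e <= j < off e + h (src F e))%N.
Proof.
move=> jt.
have [e0 e0t] : exists e, rng F e = t.
  apply: contrapT => nt; move: jt; rewrite /fibre_sum big_pred0 // => e.
  by apply/eqP => et; apply: nt; exists e.
have [e1 e1x e1t] := exists_extremal false e0.
have off1 : off e1 = 0%N.
  by rewrite /off big_pred0 // => e; apply/andP => -[/e1x-> /eqP].
pose P e := (rng F e == t) && (off e <= j)%N.
have [||e /andP[/eqP et oe] emax] := @exists_extremal_in true _ _ F P e1.
- by rewrite /P off1 e1t e0t eqxx.
- by move=> e e' /andP[/eqP-> _] /andP[/eqP-> _].
exists e; rewrite // oe /= ltnNge; apply/negP => le.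
pose Q f := (rng F f == t) && ~~ ele F f e.
have [f0 Qf0] : exists f, Q f.
  apply: contrapT => nQ; move: jt; rewrite ltnNge => /negP; apply.
  apply: leq_trans le; rewrite off_endE; apply: sub_sum => f ft.
  by apply: contrapT => /negP nl; apply: nQ; exists f; rewrite /Q ft.
have [|f /andP[/eqP ft nfe] fmin] := @exists_extremal_in false _ _ F Q f0 Qf0.
  by move=> f f' /andP[/eqP-> _] /andP[/eqP-> _].
move: nfe; rewrite emax // /P ft eqxx /=.
apply: leq_trans le; rewrite off_endE; apply: sub_sum => g /andP[gf ngf].
apply: contrapT => /negP nge.
have Qg : Q g by rewrite /Q (ele_rng gf) ft eqxx nge.
move: ngf; rewrite (_ : g = f) ?eqxx //; apply: (@ele_anti _ _ F).
by rewrite gf fmin.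
Qed.

Lemma off_min e : extremal false e <-> off e = 0%N.
Proof.
split=> [x|/eqP]; first by rewrite /off big_pred0 // => f; apply/andP => -[/x-> /eqP].
rewrite /off sum_nat_eq0 => /forallP o f l.
apply/eqP; apply/negP => /negP ne.
by have := o f; rewrite l ne /= -leqn0 leqNgt h_gt0.
Qed.

Lemma off_max e : extremal true e <-> (off e + h (src F e) = fibre_sum (rng F e))%N.
Proof.
split=> [x|E f l].
  rewrite off_endE; apply: eq_bigl => f; apply/idP/eqP => [/ele_rng//|].
  by move/ele_comparable/orP => [//|/x->]; exact: ele_refl.
apply/eqP; apply/negP => /negP; rewrite eq_sym => ne.
have := leq_trans (leq_add (off_lt l ne) (leqnn (h (src F f)))) (off_end f).
by rewrite E -(ele_rng l) -[leqRHS]addn0 leq_add2l leqNgt h_gt0.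
Qed.

End Offsets.

Arguments off {S T F} h e.
Arguments fibre_sum {S T} F h t.

(** The number of paths from the root to a vertex; it is the height of the tower
    attached to this vertex. *)
Fixpoint ht (B : obd) n : vert B n -> nat :=
  match n with
  | 0 => fun=> 1%N
  | m.+1 => fun v => fibre_sum (bedge B m) (@ht B m) v
  end.

Lemma ht_gt0 (B : obd) n (v : vert B n) : (0 < ht v)%N.
Proof.
elim: n v => //= n IH v; have [e er] := rng_surj v.
apply: leq_trans (leq_trans (IH (src _ e)) (leq_addl (off (@ht B n) e) _)) _.
by rewrite -er; exact: off_end.
Qed.

Definition ipath (B : obd) : Type := {p : forall n, bedge B n | inf_path p}.

HB.instance Definition _ (B : obd) := gen_eqMixin (ipath B).
HB.instance Definition _ (B : obd) := gen_choiceMixin (ipath B).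

Section Positions.
Variable B : obd.
Implicit Types (x y : ipath B) (p : forall n, bedge B n).

Definition edge_at x n : bedge B n := sval x n.
Definition vtx x n : vert B n := src _ (edge_at x n).

(** The rank of the initial segment of x among all the paths from the root to
    [vtx x n]. *)
Definition pos x n : nat := (\sum_(i < n) off (@ht B i) (edge_at x i))%N.

Definition agree n x y : Prop := forall i, (i < n)%N -> edge_at y i = edge_at x i.

Lemma vtxS x n : vtx x n.+1 = rng _ (edge_at x n).
Proof. exact/esym/(svalP x). Qed.

Lemma posS x n : pos x n.+1 = (pos x n + off (@ht B n) (edge_at x n))%N.
Proof. exact: big_ord_recr. Qed.

Lemma pos0 x : pos x 0 = 0%N.
Proof. exact: big_ord0. Qed.

Lemma ipath_eq x y : (forall n, edge_at x n = edge_at y n) -> x = y.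
Proof.
case: x y => [p pp] [q qq] E; apply: eq_exist => /=.
by apply: functional_extensionality_dep => n; exact: E.
Qed.

Lemma pos_lt x n : (pos x n < ht (vtx x n))%N.
Proof.
elim: n => [|n IH]; first by rewrite pos0.
rewrite posS vtxS; apply: leq_trans (off_end _ _).
by rewrite addnC ltn_add2l.
Qed.

Lemma pos_in x n : (off (@ht B n) (edge_at x n) <= pos x n.+1
  < off (@ht B n) (edge_at x n) + ht (src _ (edge_at x n)))%N.
Proof. by rewrite posS leq_addl addnC ltn_add2l; exact: pos_lt. Qed.

(** Decoding: the interval that contains the position gives the last edge, and
    subtracting its offset gives the position one level below. *)
Lemma pos_agree n x y : vtx x n = vtx y n -> pos x n = pos y n -> agree n x y.
Proof.
elim: n => // n IH; rewrite !vtxS => v pE.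
have E : edge_at x n = edge_at y n.
  apply: off_uniq v (pos_in x n) _; rewrite pE; exact: pos_in.
have /IH {}IH : vtx x n = vtx y n by rewrite /vtx E.
move=> i; rewrite ltnS leq_eqVlt => /orP[/eqP->//|]; apply: IH.
by apply/eqP; rewrite -(eqn_add2r (off (@ht B n) (edge_at x n))) -posS E -posS pE.
Qed.

Lemma agree_pos n x y : agree n x y -> pos y n = pos x n.
Proof. by move=> xy; apply: eq_bigr => i _; rewrite xy. Qed.

Lemma agree_vtx n x y : agree n.+1 x y -> vtx y n = vtx x n.
Proof. by move=> xy; rewrite /vtx xy. Qed.

Lemma agreeW m n x y : (m <= n)%N -> agree n x y -> agree m x y.
Proof. by move=> mn xy i im; apply: xy; exact: leq_trans im mn. Qed.

Lemma agree_sym n x y : agree n x y -> agree n y x.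
Proof. by move=> xy i im; rewrite xy. Qed.

(** Decoding as in [pos_agree], here to construct a path: the edges of p below
    level n are replaced one by one, from the top. *)
Lemma splice_tail n p j : (forall i, (n <= i)%N -> rng _ (p i) = src _ (p i.+1)) ->
  (j < ht (src _ (p n)))%N ->
  exists x, (forall i, (n <= i)%N -> edge_at x i = p i) /\ pos x n = j.
Proof.
elim: n p j => [|n IH] p j pp jn.
  have pp' : inf_path p by move=> i; exact: pp.
  exists (exist _ p pp'); split => //; rewrite pos0.
  by move: jn; rewrite ltnS leqn0 => /eqP.
have [e er /andP[oj je]] := @off_ex _ _ (bedge B n) (@ht B n) _ _ jn.
pose q := @dfwith nat (fun i => bedge B i : Type) p n e.
have qn : q n = e by exact: dfwithin.
have qE i : (n < i)%N -> q i = p i.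
  by move=> ni; apply: dfwithout; rewrite ltn_eqF.
have [i||x [xq xj]] := IH q (j - off (@ht B n) e)%N.
- rewrite leq_eqVlt => /orP[/eqP<-|ni]; first by rewrite qn qE.
  by rewrite !qE // ?pp // ltnW.
- by rewrite qn ltn_subLR.
exists x; split=> [i ni|]; first by rewrite xq ?qE // ltnW.
by rewrite posS xj xq // qn subnK.
Qed.

Lemma splice x n j : (j < ht (vtx x n))%N ->
  exists y, (forall i, (n <= i)%N -> edge_at y i = edge_at x i) /\ pos y n = j.
Proof. by move=> jn; apply: splice_tail => // i _; exact: (svalP x). Qed.

(** Any path of edges that leaves v can be continued backwards by [splice_tail].
    The sequence [w] follows chosen edges from level to level, but is reset to v
    at level n; it need not be coherent below. *)
Lemma exists_path_at n (v : vert B n) j : (j < ht v)%N ->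
  exists x, vtx x n = v /\ pos x n = j.
Proof.
move=> jv.
have ex0 i : exists w : vert B i, True.
  by have /card_gt0P[w _] := vert_gt0 B i; exists w.
pose d i := projT1 (cid (ex0 i)).
pose nx i (w : vert B i) := projT1 (cid (src_surj w)).
have nxP i w : src _ (@nx i w) = w := projT2 (cid (src_surj w)).
pose upd := @dfwith nat (fun i => vert B i : Type).
pose fix w i : vert B i := match i with
  | 0 => upd d n v 0
  | k.+1 => upd (upd d k.+1 (rng _ (nx k (w k)))) n v k.+1
  end.
have wn : w n = v.
  by case: n v jv @w => [|n] v jv w; rewrite /w /= /upd dfwithin.
have wS i : (n <= i)%N -> w i.+1 = rng _ (nx i (w i)).
  by move=> ni; rewrite /= /upd dfwithout ?dfwithin // ltn_eqF.
have [i ni||x [xE xj]] := @splice_tail n (fun i => nx i (w i)) j.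
- by rewrite nxP wS.
- by rewrite nxP wn.
by exists x; split => //; rewrite /vtx xE // nxP wn.
Qed.

End Positions.

(** * The compact metrizable space of infinite paths *)

Section PathTopology.
Variable B : obd.
Implicit Types x y : ipath B.

Definition cylinder n x : set (ipath B) := [set y | agree n x y].

Definition ipath_nbhs x : set_system (ipath B) := filter_from setT (cylinder^~ x).

HB.instance Definition _ := hasNbhs.Build (ipath B) ipath_nbhs.

Fact ipath_nbhs_filter x : ProperFilter (ipath_nbhs x).
Proof.
apply: filter_from_proper => [|n _]; last by exists x => i.
apply: filter_from_filter; first by exists 0%N.
move=> m n _ _; exists (maxn m n) => // y xy.
by split; apply: agreeW xy; [exact: leq_maxl|exact: leq_maxr].
Qed.

Fact ipath_nbhs_singleton x A : ipath_nbhs x A -> A x.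
Proof. by case=> n _; apply => i. Qed.

Fact ipath_nbhs_nbhs x A : ipath_nbhs x A -> ipath_nbhs x (ipath_nbhs^~ A).
Proof.
case=> n _ xA; exists n => // y xy; exists n => // z yz; apply: xA => i im.
by rewrite yz // xy.
Qed.

HB.instance Definition _ := Nbhs_isNbhsTopological.Build (ipath B)
  ipath_nbhs_filter ipath_nbhs_singleton ipath_nbhs_nbhs.

Lemma local_open n (A : set (ipath B)) :
  (forall x y, agree n x y -> A x -> A y) -> open A.
Proof.
by move=> h; rewrite openE => x Ax; exists n => // y xy; exact: h xy Ax.
Qed.

Lemma local_clopen n (A : set (ipath B)) :
  (forall x y, agree n x y -> A x -> A y) -> clopen A.
Proof.
move=> h; split; first exact: local_open h.
rewrite -openC; apply: (@local_open n) => x y xy nA Ay; apply: nA.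
by apply: h Ay; exact: agree_sym.
Qed.

(** An ultrafilter selects one edge at each level, as there are finitely many;
    these edges form the path to which it converges. *)
Lemma ipath_compact : compact [set: ipath B].
Proof.
rewrite compact_ultra => F FU _.
have sel n : exists e, F [set x | edge_at x n = e].
  apply: contrapT => ns.
  have : F [set x | forall e, edge_at x n <> e].
    apply: filter_forall => e.
    have [/= Fe|//] := in_ultra_setVsetC [set x | edge_at x n = e] FU.
    by case: ns; exists e.
  by move=> /filter_ex[x /(_ (edge_at x n))]; apply.
pose p n := projT1 (cid (sel n)).
have pF n : F [set x | edge_at x n = p n] := projT2 (cid (sel n)).
have pp : inf_path p.
  move=> n; have [x [/= <- <-]] := filter_ex (filterI (pF n) (pF n.+1)).
  exact: (svalP x).
exists (exist _ p pp); split => // A [n _ nA]; apply: filterS nA _.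
elim: n => [|n IH]; first by apply: filterS filterT => x _ i.
apply: filterS (filterI IH (pF n)) => x [/= xn xp] i.
by rewrite ltnS leq_eqVlt => /orP[/eqP->|/xn].
Qed.

Lemma ipath_zero_dimensional : zero_dimensional (ipath B).
Proof.
move=> x y xy.
have [n ne] : exists n, edge_at x n <> edge_at y n.
  apply: contrapT => h; move/eqP: xy; apply; apply: ipath_eq => n.
  by apply: contrapT => ne; apply: h; exists n.
exists [set z | edge_at z n = edge_at x n]; split => //=; last by move=> E; apply: ne.
by apply: (@local_clopen n.+1) => z t zt /= <-; rewrite zt.
Qed.

(** A map whose graph is a decreasing intersection of relations that only depend
    on finitely many edges is continuous, by compactness. *)
Lemma graph_continuous (r : nat -> ipath B -> ipath B -> Prop)
    (f : ipath B -> ipath B) :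
  (forall n x x' y y', agree n.+1 x x' -> agree n.+1 y y' -> r n x y -> r n x' y') ->
  (forall n x y, r n.+1 x y -> r n x y) ->
  (forall x y, (forall n, r n x y) <-> f x = y) -> continuous f.
Proof.
move=> rloc rdec rf x A; rewrite nbhsE => -[O [oO Ofx] OA].
have rx : forall n, r n x (f x) by apply/rf.
have [||//||n nO] := @compact_shrink _ (fun n => [set y | r n x y]) O ipath_compact.
- by move=> n; apply: (@local_clopen n.+1 _ _).2 => y z yz; exact: rloc.
- by move=> n y; exact: rdec.
- by move=> y h; have <- : f x = y by apply/rf => n; exact: h.
exists n.+1 => // x' xx'; apply/OA/nO.
have rx' : forall n, r n x' (f x') by apply/rf.
by apply: rloc (rx' n) => //; exact: agree_sym.
Qed.

Lemma ipath_metrizable (R : realType) : metrizable R (ipath B).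
Proof.
pose differ x y n := edge_at x n != edge_at y n.
have sameP x y : ~ (exists n, differ x y n) -> x = y.
  move=> h; apply: ipath_eq => n; apply/eqP/negP => /negP ne.
  by apply: h; exists n.
(* The distance is 1 / (k + 1), where k is the first level of disagreement. *)
pose d x y : R := if pselect (exists n, differ x y n) is left h
  then ((ex_minn h).+1%:R^-1)%R else 0%R.
have dgt x y n : differ x y n -> (n.+1%:R^-1 <= d x y)%R.
  move=> xyn; rewrite /d; case: pselect => [h|[]]; last by exists n.
  case: ex_minnP => m _ /(_ _ xyn) mn.
  by rewrite lef_pV2 ?posrE ?ltr0n // ler_nat ltnS.
have dcase x y : (d x y = 0%R /\ x = y) \/
    exists n, differ x y n /\ d x y = (n.+1%:R^-1)%R /\ agree n x y.
  rewrite /d; case: pselect => [h|h]; last by left; split => //; exact: sameP.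
  right; case: ex_minnP => n xyn nmin; exists n; split => //; split => // i lt.
  apply/eqP/negP => /negP ne.
  by have := nmin i; rewrite /differ eq_sym => /(_ ne); rewrite leqNgt lt.
have d0 x : d x x = 0%R.
  by case: (dcase x x) => [[]//|[n []]]; rewrite /differ eqxx.
have dge0 x y : (0 <= d x y)%R.
  by case: (dcase x y) => [[->]//|[n [_ [-> _]]]]; rewrite invr_ge0 ler0n.
exists d; split => //.
- move=> x y; split=> [|->]; last exact: d0.
  case: (dcase x y) => [[]//|[n [_ [-> _]]]] /eqP.
  by rewrite invr_eq0 pnatr_eq0.
- move=> x y; rewrite /d; have E n : differ x y n = differ y x n by rewrite /differ eq_sym.
  case: pselect => h; case: pselect => h' //.
  + congr (_.+1%:R^-1)%R; case: ex_minnP => m mP mm; case: ex_minnP => n nP nm.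
    by apply/eqP; rewrite eqn_leq mm ?nm // ?E // -E.
  + by case: h'; case: h => n; rewrite E; exists n.
  + by case: h; case: h' => n; rewrite -E; exists n.
- move=> x y z; case: (dcase x z) => [[-> _]|[n [xz [-> _]]]].
    by rewrite addr_ge0.
  have [xy|yz] : differ x y n \/ differ y z n.
  + by rewrite /differ; case: (eqVneq (edge_at x n) (edge_at y n)) => [<-|]; [right|left].
  + by apply: le_trans (dgt _ _ _ xy) _; rewrite lerDl.
  + by apply: le_trans (dgt _ _ _ yz) _; rewrite lerDr.
move=> x A; split=> [[n _ nA]|[e e0 eA]].
  exists n.+1%:R^-1%R; first by rewrite invr_gt0 ltr0n.
  move=> y /= dxy; apply: nA => i lt; apply/eqP/negP => /negP ne.
  have := dgt x y i; rewrite /differ eq_sym => /(_ ne) /le_lt_trans /(_ dxy).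
  by rewrite ltf_pV2 ?posrE ?ltr0n // ltr_nat ltnS leqNgt ltnS ltnW.
have [n ne] : exists n : nat, (n.+1%:R^-1 < e)%R.
  exists (Num.truncn e^-1); rewrite -[ltRHS]invrK ltf_pV2 ?posrE ?ltr0n ?invr_gt0 //.
  exact: truncnS_gt.
exists n => // y xy; apply: eA => /=; apply: le_lt_trans ne.
case: (dcase x y) => [[-> _]|[m [xym [-> _]]]]; first by rewrite invr_ge0 ler0n.
rewrite lef_pV2 ?posrE ?ltr0n // ler_nat ltnS leqNgt; apply/negP => /xy E.
by move: xym; rewrite /differ E eqxx.
Qed.

End PathTopology.

(** * The Vershik map and its Kakutani-Rokhlin partitions *)

Section Successor.
Variable B : obd.
Implicit Types x y : ipath B.

Definition at_top x n : Prop := (pos x n).+1 = ht (vtx x n).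

(** What a finite level shows of the successor of x. In the second case the
    vertex of y is left open, as it depends on edges of x above level n. *)
Definition next_at n x y : Prop :=
  (vtx y n = vtx x n /\ pos y n = (pos x n).+1) \/ (at_top x n /\ pos y n = 0%N).

Definition next x y : Prop := forall n, next_at n x y.

Lemma at_top_edge x n : at_top x n.+1 <-> at_top x n /\ extremal true (edge_at x n).
Proof.
have xE : extremal true (edge_at x n) <->
    (off (@ht B n) (edge_at x n) + ht (vtx x n) = ht (rng _ (edge_at x n)))%N.
  exact: off_max (@ht_gt0 B n) _.
rewrite xE /at_top posS vtxS -addSn.
split=> [E|[-> <-]]; last by rewrite addnC.
have le := off_end (@ht B n) (edge_at x n).
have E1 : (pos x n).+1 = ht (vtx x n).
  apply/eqP; rewrite eqn_leq pos_lt /=.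
  rewrite -(leq_add2r (off (@ht B n) (edge_at x n))) E /= addnC; exact: le.
by split => //; rewrite addnC -[X in (X + _)%N]E1.
Qed.

Lemma at_topW m n x : (m <= n)%N -> at_top x n -> at_top x m.
Proof. by move=> /subnK<-; elim: (n - m)%N => // d IH /at_top_edge[/IH]. Qed.

Lemma bottomW m n x : (m <= n)%N -> pos x n = 0%N -> pos x m = 0%N.
Proof.
move=> /subnK<-; elim: (n - m)%N => // d IH.
by rewrite addSn posS => /eqP; rewrite addn_eq0 => /andP[/eqP/IH].
Qed.

(** Positions stay below the height, so the two cases of [next_at] exclude each
    other and either endpoint tells which one holds. *)
Lemma next_at_top n x y : next_at n x y -> at_top x n <-> pos y n = 0%N.
Proof.
case=> [[v p]|[t p]] //; rewrite p; split => // t.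
by have := pos_lt y n; rewrite p v t ltnn.
Qed.

(** Adding one to a mixed-radix number: if x is not at the top at level n, the
    next position lies in the interval of the same edge; otherwise it is the first
    position in the interval of another edge, so y is at the bottom at level n. *)
Lemma next_atS n x y : next_at n.+1 x y -> next_at n x y.
Proof.
case=> [[v p]|[/at_top_edge[t _] p]]; last by right; split=> //; exact: bottomW p.
have vr : rng _ (edge_at x n) = rng _ (edge_at y n) by rewrite -!vtxS.
have yin := pos_in y n; have xin := pos_in x n.
have [lt|] := ltnP (pos x n).+1 (ht (vtx x n)).
  have E : edge_at x n = edge_at y n.
    apply: off_uniq vr _ yin; rewrite p posS -addSn leq_addl /= addnC ltn_add2l.
    exact: lt.
  left; split; first by rewrite /vtx E.
  by move: p; rewrite !posS E -addSn => /addIn.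
rewrite leq_eqVlt ltnNge pos_lt orbF => /eqP/esym t.
right; split; first by [].
apply/eqP; rewrite -leqn0 leqNgt; apply/negP => y0.
have E : edge_at x n = edge_at y n.
  apply: off_uniq vr xin _; move: yin; rewrite p => /andP[_ /ltnW -> ].
  rewrite andbT -ltnS -p posS -[X in (X < _)%N]add0n ltn_add2r; exact: y0.
by have := pos_lt y n; move: p; rewrite !posS E -addSn => /addIn->; rewrite t /vtx E ltnn.
Qed.

Lemma next_atW m n x y : (m <= n)%N -> next_at n x y -> next_at m x y.
Proof. by move=> /subnK<-; elim: (n - m)%N => // d IH /next_atS/IH. Qed.

Lemma next_at_local n x x' y y' : agree n.+1 x x' -> agree n.+1 y y' ->
  next_at n x y -> next_at n x' y'.
Proof.
move=> xx yy; rewrite /next_at /at_top !(agree_vtx xx) !(agree_vtx yy).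
by rewrite !(agree_pos (agreeW (leqnSn n) xx)) !(agree_pos (agreeW (leqnSn n) yy)).
Qed.

(** A change of the position by one at level N, without change of the edges above,
    changes the positions at all higher levels by one. *)
Lemma tail_next x y N : (forall i, (N <= i)%N -> edge_at y i = edge_at x i) ->
  pos y N = (pos x N).+1 -> next x y.
Proof.
move=> yx p n.
have h m : (N <= m)%N -> next_at m x y.
  move=> Nm; left; split; first by rewrite /vtx yx.
  move: Nm => /subnK<-; elim: (m - N)%N => // d IH.
  by rewrite addSn !posS IH yx // leq_addl.
by apply: (next_atW (leq_maxl n N)); apply: h; exact: leq_maxr.
Qed.

Lemma next_ex x : ~ (forall n, at_top x n) -> exists y, next x y.
Proof.
move=> /existsNP[N nt].
have [|y [yx p]] := @splice _ x N (pos x N).+1.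
  by rewrite ltn_neqAle pos_lt andbT; apply/eqP.
by exists y; exact: tail_next yx p.
Qed.

Lemma prev_ex y : ~ (forall n, pos y n = 0%N) -> exists x, next x y.
Proof.
move=> /existsNP[N nt].
have p0 : (0 < pos y N)%N by rewrite lt0n; apply/eqP.
have [|x [yx p]] := @splice _ y N (pos y N).-1.
  by rewrite prednK // ltnW // pos_lt.
by exists x; apply: (@tail_next _ _ N) => [i /yx//|]; rewrite p prednK.
Qed.

Lemma ipath_eq_pos x y N :
  (forall n, (N <= n)%N -> vtx x n = vtx y n /\ pos x n = pos y n) -> x = y.
Proof.
move=> h; apply: ipath_eq => n.
have [|v p] := h (maxn N n.+1); first exact: leq_maxl.
by have := pos_agree v p; move=> /(_ n); rewrite leq_maxr => ->.
Qed.

(** Once x is below the top, it is so at all higher levels, where [next_at] then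
    prescribes both vertex and position. *)
Lemma next_uniq x y y' : ~ (forall n, at_top x n) -> next x y -> next x y' -> y = y'.
Proof.
move=> /existsNP[N nt] xy xy'; apply: (@ipath_eq_pos _ _ N) => n Nn.
have nt' : ~ at_top x n by move=> /(at_topW Nn).
by case: (xy n) => [[-> ->]|[]//]; case: (xy' n) => [[-> ->]|[]].
Qed.

Lemma prev_uniq x x' y : ~ (forall n, pos y n = 0%N) -> next x y -> next x' y -> x = x'.
Proof.
move=> /existsNP[N nt] xy xy'; apply: (@ipath_eq_pos _ _ N) => n Nn.
have nt' : pos y n <> 0%N by move=> /(bottomW Nn).
by case: (xy n) => [[<- e]|[]//]; case: (xy' n) => [[<-]|[]//]; rewrite e => -[].
Qed.

Lemma all_top x : (forall n, at_top x n) <-> forall n, extremal true (edge_at x n).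
Proof.
split=> [h n|h n]; first by have /at_top_edge[] := h n.+1.
elim: n => [|n IH]; first by rewrite /at_top pos0.
by apply/at_top_edge.
Qed.

Lemma all_bottom x : (forall n, pos x n = 0%N) <-> forall n, extremal false (edge_at x n).
Proof.
split=> [h n|h n].
  apply/(off_min (@ht_gt0 B n)).
  by have := h n.+1; rewrite posS h.
elim: n => [|n IH]; first exact: pos0.
rewrite posS IH add0n; exact/(off_min (@ht_gt0 B n)).
Qed.

End Successor.

Section Vershik.
Variable B : obd.
Implicit Types x y : ipath B.
Variables xmax xmin : ipath B.
Hypothesis xmaxP : forall x, (forall n, at_top x n) <-> x = xmax.
Hypothesis xminP : forall x, (forall n, pos x n = 0%N) <-> x = xmin.

Lemma next_ends : next xmax xmin.
Proof.
move=> n; right; split; first by have /xmaxP := erefl xmax; apply.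
by have /xminP := erefl xmin; apply.
Qed.

(** If x is maximal, then [next x y] says that y is at the bottom at every level,
    that is, minimal: here existence and uniqueness of y are those of the minimal
    path. *)
Lemma next_total x : exists! y, next x y.
Proof.
have [/xmaxP->|nt] := pselect (forall n, at_top x n).
  exists xmin; split; first exact: next_ends.
  move=> y h; apply/esym/xminP => n; apply/(next_at_top (h n)).
  by have /xmaxP := erefl xmax; apply.
have [y xy] := next_ex nt; exists y; split => // y'; exact: next_uniq nt xy.
Qed.

Lemma prev_total y : exists! x, next x y.
Proof.
have [/xminP->|nt] := pselect (forall n, pos y n = 0%N).
  exists xmax; split; first exact: next_ends.
  move=> x h; apply/esym/xmaxP => n; apply/(next_at_top (h n)).
  by have /xminP := erefl xmin; apply.
have [x xy] := prev_ex nt; exists x; split => // x'; exact: prev_uniq nt xy.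
Qed.

Definition vershik x : ipath B := projT1 (cid (next_total x)).
Definition vershik_inv y : ipath B := projT1 (cid (prev_total y)).

Lemma vershikP x y : next x y <-> vershik x = y.
Proof.
rewrite /vershik; case: cid => z [/= xz zu].
by split=> [/zu//|<-].
Qed.

Lemma vershik_invP x y : next x y <-> vershik_inv y = x.
Proof.
rewrite /vershik_inv; case: cid => z [/= xz zu].
by split=> [/zu//|<-].
Qed.

Lemma vershikK : cancel vershik vershik_inv.
Proof. by move=> x; apply/vershik_invP/vershikP. Qed.

Lemma vershik_invK : cancel vershik_inv vershik.
Proof. by move=> x; apply/vershikP/vershik_invP. Qed.

Lemma vershik_homeo : homeomorphism vershik.
Proof.
split.
  apply: (@graph_continuous _ (@next_at B)) => [n x x' y y'|n x y|x y].
  - exact: next_at_local.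
  - exact: next_atS.
  - exact: vershikP.
exists vershik_inv; split; [exact: vershikK|exact: vershik_invK|].
apply: (@graph_continuous _ (fun n x y => next_at n y x)) => [n x x' y y'|n x y|x y].
- by move=> xx yy; exact: next_at_local.
- exact: next_atS.
- exact: vershik_invP.
Qed.

Definition cell n (v : vert B n) j : set (ipath B) :=
  [set x | vtx x n = v /\ pos x n = j].

Fact cell_clopen n (v : vert B n) j : (j < ht v)%N -> clopen (cell v j).
Proof.
move=> _; apply: (@local_clopen _ n.+1) => x y xy [<- <-].
by rewrite /cell /= (agree_vtx xy) (agree_pos (agreeW (leqnSn n) xy)).
Qed.

Fact cell_neq0 n (v : vert B n) j : (j < ht v)%N -> cell v j !=set0.
Proof. by move=> /exists_path_at[x]; exists x. Qed.

Fact cell_disjoint n (v : vert B n) j (v' : vert B n) j' : (j < ht v)%N -> (j' < ht v')%N ->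
  cell v j `&` cell v' j' !=set0 -> v = v' /\ j = j'.
Proof. by move=> _ _ [x [[<- <-] [<- <-]]]. Qed.

Fact cell_cover n x : exists (v : vert B n) j, (j < ht v)%N /\ cell v j x.
Proof. by exists (vtx x n), (pos x n); split; [exact: pos_lt|split]. Qed.

Fact cell_step n (v : vert B n) j : (j.+1 < ht v)%N ->
  vershik @` cell v j = cell v j.+1.
Proof.
move=> jv; apply/seteqP; split=> [_ [x [xv xj] <-]|y [yv yj]].
  have /vershikP/(_ n)[[e p]|[t _]] := erefl (vershik x).
    by rewrite /cell /= e p xv xj.
  by move: jv; rewrite -xj -xv t ltnn.
exists (vershik_inv y); last exact: vershik_invK.
have /vershik_invP/(_ n)[[e p]|[_ p]] := erefl (vershik_inv y).
  by split; rewrite -?e //; move: p; rewrite yj => -[].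
by move: p; rewrite yj.
Qed.

Lemma top_cellP n (v : vert B n) x : cell v (ht v).-1 x <-> v = vtx x n /\ at_top x n.
Proof.
rewrite /at_top; split=> [[<- ->]|[-> <-]]; first by rewrite prednK // ht_gt0.
by split.
Qed.

Fact cell_top_xmax n : exists v : vert B n, cell v (ht v).-1 xmax.
Proof.
exists (vtx xmax n); apply/top_cellP; split => //.
by have /xmaxP := erefl xmax; apply.
Qed.

Lemma tops_at_top n : \bigcup_(v : vert B n) cell v (ht v).-1 = [set x | at_top x n].
Proof.
apply/seteqP; split=> [x [v _ /top_cellP[]]//|x xt].
by exists (vtx x n) => //; apply/top_cellP.
Qed.

Fact cell_top_bottom n : vershik @` (\bigcup_(v : vert B n) cell v (ht v).-1)
  = \bigcup_(v : vert B n) cell v 0.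
Proof.
rewrite tops_at_top; apply/seteqP; split=> [_ [x xt <-]|y [v _ [_ y0]]].
  exists (vtx (vershik x) n) => //; split => //.
  by have /vershikP/(_ n)/next_at_top h := erefl (vershik x); apply/h.
exists (vershik_inv y); last exact: vershik_invK.
by have /vershik_invP/(_ n)/next_at_top h := erefl (vershik_inv y); apply/h.
Qed.

Definition path_kr n : kr_partition vershik xmax :=
  @KR (ipath B) vershik xmax (vert B n) (@ht B n) (@cell n) (@ht_gt0 B n)
    (@cell_clopen n) (@cell_neq0 n) (@cell_disjoint n) (@cell_cover n)
    (@cell_step n) (@cell_top_xmax n) (@cell_top_bottom n).

Lemma ktop_path_kr n : ktop (path_kr n) = [set x | at_top x n].
Proof. exact: tops_at_top. Qed.

Lemma kcells_path_kr n x : kcells (path_kr n) (cell (vtx x n) (pos x n)).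
Proof. by exists (vtx x n), (pos x n); split => //; exact: pos_lt. Qed.

Lemma cell_cylinder n x : cell (vtx x n) (pos x n) `<=` cylinder n x.
Proof. by move=> y [v p]; apply: pos_agree. Qed.

Lemma path_kr0 : kcells (path_kr 0) = [set [set: ipath B]].
Proof.
have V0 (v w : vert B 0) : v = w.
  have /card_le1_eqP h : (#|vert B 0| <= 1)%N by rewrite vert0.
  exact: h.
have all (v : vert B 0) j : (j < 1)%N -> cell v j = [set: ipath B].
  rewrite ltnS leqn0 => /eqP->; apply/seteqP; split => // x _.
  by split; [exact: V0|exact: pos0].
apply/seteqP; split=> [A [v [j [jv ->]]]|A ->]; first exact: all jv.
by exists (vtx xmax 0), 0%N; split => //; apply/esym; exact: all.
Qed.

(** A cell at level n.+1 fixes the first n.+1 edges, hence the vertex and the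
    position at level n. *)
Lemma path_kr_refines n : krefines (path_kr n) (path_kr n.+1).
Proof.
move=> A [v [j [jv ->]]]; have [x [<- <-]] := exists_path_at jv.
exists (cell (vtx x n) (pos x n)); first exact: kcells_path_kr.
move=> y /cell_cylinder xy; split; first exact: agree_vtx.
exact: agree_pos (agreeW (leqnSn n) xy).
Qed.

Lemma path_kr_top_decr n : (0 < n)%N ->
  ktop (path_kr n.+1) `<=` ktop (path_kr n).
Proof. by move=> _; rewrite !ktop_path_kr => x; exact: at_topW. Qed.

Lemma path_kr_top_inter :
  \bigcap_(n in [set n | (0 < n)%N]) ktop (path_kr n) = [set xmax].
Proof.
apply/seteqP; split=> [x h|x -> n _]; last first.
  by rewrite ktop_path_kr; have /xmaxP := erefl xmax; apply.
apply/xmaxP => n; apply: (at_topW (leqnSn n)).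
by have := h n.+1 isT; rewrite ktop_path_kr.
Qed.

Lemma path_kr_basis : basis (\bigcup_n kcells (path_kr n)).
Proof.
split=> [A [n _ [v [j [jv ->]]]]|x A [n _ nA]]; first by case: (cell_clopen jv).
exists (cell (vtx x n) (pos x n)); last exact: subset_trans (@cell_cylinder _ _) nA.
by split => //; exists n => //; exact: kcells_path_kr.
Qed.

(** Every orbit climbs to the top of its tower at each level, and the tops
    shrink to the maximal path. *)
Lemma closed_invariant_xmax (M : set (ipath B)) :
  closed_invariant vershik M -> M xmax.
Proof.
move=> [[x0 Mx0] cM iM]; apply: contrapT => nM.
have [|||||n nsub] := @compact_shrink _ (fun n => [set x | at_top x n]) (~` M).
- exact: ipath_compact.
- move=> n; apply: (@local_clopen _ n.+1 _ _).2 => x y xy.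
  by rewrite /at_top /= (agree_vtx xy) (agree_pos (agreeW (leqnSn n) xy)).
- by move=> n x; exact: at_topW.
- exact: closed_openC.
- by move=> x h; have -> : x = xmax by apply/xmaxP => n; exact: h.
(* The number of remaining steps k decreases under the Vershik map. *)
have climb k x : M x -> (ht (vtx x n) - (pos x n).+1 = k)%N -> exists2 y, M y & at_top y n.
  elim: k x => [|k IH] x Mx E.
    exists x => //; apply/eqP; rewrite /at_top eqn_leq pos_lt /=.
    by rewrite -subn_eq0 E.
  have Mx' : M (vershik x) by rewrite -iM; exists x.
  have /vershikP/(_ n)[[v p]|[t _]] := erefl (vershik x).
    by apply: (IH _ Mx'); rewrite v p subnS E.
  by move: E; rewrite t subnn.
have [y My yt] := climb _ x0 Mx0 erefl.
exact: nsub yt My.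
Qed.

(** The intersection of all closed invariant sets is not empty, as it contains
    the maximal path; hence it is the only minimal set. *)
Lemma vershik_essmin (R : realType) : essentially_minimal R vershik xmax.
Proof.
split; first exact: ipath_metrizable.
- exact: ipath_compact.
- exact: zero_dimension_totally_disconnected (@ipath_zero_dimensional B).
- exact: vershik_homeo.
pose M := [set x | forall N, closed_invariant vershik N -> N x].
have MN N : closed_invariant vershik N -> M `<=` N by move=> cN x; apply.
have cM : closed_invariant vershik M.
  split; first by exists xmax => N; exact: closed_invariant_xmax.
    have -> : M = \bigcap_(N in [set N | closed_invariant vershik N]) N by [].
    by apply: closed_bigI => N [].
  apply/seteqP; split=> [_ [x Mx <-] N cN|y My].
    by have [_ _ <-] := cN; exists x => //; exact: Mx.
  exists (vershik_inv y); last exact: vershik_invK.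
  move=> N cN; have := My _ cN; have [_ _ {1}<-] := cN.
  by move=> [x Nx <-]; rewrite vershikK.
exists M; split.
- split => // N cN NM; apply/seteqP; split => //; exact: MN.
- by move=> M' [cM' minM']; apply/esym/minM' => //; exact: MN.
- by move=> N; exact: closed_invariant_xmax.
Qed.

Definition path_sds (R : realType) : sds R :=
  @SDS R (ipath B) vershik xmax (vershik_essmin R) path_kr path_kr0
    path_kr_refines path_kr_top_decr path_kr_top_inter path_kr_basis.

End Vershik.

(** * Recovering the diagram from its space of paths *)

(** The transport along E only serves to compare edge sets that end at
    propositionally equal levels. *)
Lemma premor_equiv_congr (B C : obd) (f f' h : premor B C)
    (E : pidx f = pidx f') :
  (forall n, oiso (eq_rect _ (fun i => oedge (vert B n) (vert C (i n)))
                     (pedge f n) _ E) (pedge f' n)) ->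
  premor_equiv f h -> premor_equiv f' h.
Proof.
case: f f' E => [i F ? ? ? ? ? ? ? ?] [i' F' ? ? ? ? ? ? ? ?] /= E.
subst i' => /= FF [n [m [n0 nm fm e1 e2]]]; exists n, m; split => // k /=.
  exact: oiso_trans (e1 k) (ocomp_congr (FF _) (oiso_refl _)).
exact: oiso_trans (ocomp_congr (oiso_refl _) (oiso_sym (FF _))) (e2 k).
Qed.

Lemma premor_equiv_id (B : obd) : premor_equiv (premor_id B) (premor_id B).
Proof.
have iso k l : oiso (ocomp (span B k l) (odiag (vert B) l l))
    (ocomp (odiag (vert B) k k) (span B k l)).
  exact: oiso_trans (comp_odiag _) (oiso_sym (odiag_comp _)).
exists (fun k => k.*2.+1), (fun k => k.+1.*2); split => // k.
- by rewrite doubleS !ltnS leqnn.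
- by rewrite /= doubleS !ltnS leqnn.
Qed.

(** The diagonal edge sets form premorphisms in both directions, and compose to
    diagonal edge sets. *)
Lemma obd_iso_same_vert (B : obd)
    (E : forall n, oedge (vert B n) (vert B n.+1)) h1 h2 h3 h4 h5 :
  (forall n, oiso (bedge B n) (E n)) -> obd_iso B (@OBD (vert B) E h1 h2 h3 h4 h5).
Proof.
set C := OBD _ _ _ _ _ => BE.
pose F n : oedge (vert B n) (vert B n) := odiag (vert B) n n.
have spanC n : oiso (span C n n.+1) (E n).
  by rewrite spanS // span_id; exact: odiag_comp.
have spanB n : oiso (span B n n.+1) (bedge B n).
  by rewrite spanS // span_id; exact: odiag_comp.
have sqf n : oiso (ocomp (bedge B n) (F n.+1)) (ocomp (F n) (span C n n.+1)).
  apply: oiso_trans (comp_odiag _) _; apply: oiso_trans (BE n) _.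
  apply: oiso_trans (oiso_sym (spanC n)) _; exact: oiso_sym (odiag_comp _).
have sqg n : oiso (ocomp (E n) (F n.+1)) (ocomp (F n) (span B n n.+1)).
  apply: oiso_trans (comp_odiag _) _; apply: oiso_trans (oiso_sym (BE n)) _.
  apply: oiso_trans (oiso_sym (spanB n)) _; exact: oiso_sym (odiag_comp _).
pose ub N := ex_intro (fun n => (N < id n)%N) N.+1 (leqnn N.+1).
pose f : premor B C := @Premor B C id F erefl leqnSn ub (@premor_id_gt0 B)
  (@premor_id_src B) (@premor_id_rng B) (@premor_id_card0 B) sqf.
pose g : premor C B := @Premor C B id F erefl leqnSn ub (@premor_id_gt0 B)
  (@premor_id_src B) (@premor_id_rng B) (@premor_id_card0 B) sqg.
have FF n : oiso (ocomp (F n) (F n)) (F n) by exact: odiag_comp.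
exists f, g; split; apply: funext => h; apply: propext; split.
- exact: (@premor_equiv_congr B B (premor_comp f g) (premor_id B) h erefl FF).
- apply: (@premor_equiv_congr B B (premor_id B) (premor_comp f g) h erefl) => n.
  exact: oiso_sym (FF n).
- exact: (@premor_equiv_congr C C (premor_comp g f) (premor_id C) h erefl FF).
- apply: (@premor_equiv_congr C C (premor_id C) (premor_comp g f) h erefl) => n.
  exact: oiso_sym (FF n).
Qed.

(** The crossing attached to an edge e starts at position off e: exactly there the
    paths into the range of e pass through e and start at the bottom of the tower
    of its source. A crossing is determined by its range and its starting
    position. *)
Lemma path_kedges (B : obd) (xmax xmin : ipath B)
    (xmaxP : forall x, (forall n, at_top x n) <-> x = xmax)
    (xminP : forall x, (forall n, pos x n = 0%N) <-> x = xmin) n :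
  oiso (bedge B n) (kedges (path_kr xmaxP xminP n) (path_kr xmaxP xminP n.+1)).
Proof.
set P := path_kr xmaxP xminP.
have offP (e : bedge B n) : exists K : kedges (P n) (P n.+1),
    [/\ src _ K = src _ e, rng _ K = rng _ e & kedge_off K = off (@ht B n) e].
  apply: kedge_at.
  - by rewrite !ktop_path_kr => x; exact: at_topW.
  - apply: leq_trans (off_end (@ht B n) e); rewrite -[X in (X < _)%N]addn0 ltn_add2l.
    exact: ht_gt0.
  - move=> x [xv xp].
    have E : edge_at x n = e.
      apply: off_uniq (pos_in x n) _; rewrite -?vtxS // xp leqnn /=.
      by rewrite -[X in (X < _)%N]addn0 ltn_add2l ht_gt0.
    split; first by rewrite /vtx E.
    by move: xp; rewrite posS E => /eqP; rewrite -[X in _ == X]add0n eqn_add2r => /eqP.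
pose phi e := projT1 (cid (offP e)).
have phiP e : [/\ src _ (phi e) = src _ e, rng _ (phi e) = rng _ e &
  kedge_off (phi e) = off (@ht B n) e] := projT2 (cid (offP e)).
have phi_le e e' : ele (kedges (P n) (P n.+1)) (phi e) (phi e') = ele (bedge B n) e e'.
  have [_ r o] := phiP e; have [_ r' o'] := phiP e'.
  rewrite -[LHS]/((rng _ (phi e) == rng _ (phi e')) && _) r r' o o'.
  have [E|ne] := eqVneq; first by rewrite (off_le (@ht_gt0 B n) E).
  by apply/esym/negP => /ele_rng/eqP; apply/negP.
have phi_inj : injective phi.
  move=> e e' E; apply: (@ele_anti _ _ (bedge B n)).
  by rewrite -!phi_le E ele_refl.
have phi_onto K : exists e, phi e = K.
  have [lt _ /(_ 0%N (height_gt0 _))] := kedgeP K; rewrite addn0 => sub.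
  have [x xK] := kcell_neq0 lt; have [_ p0] := sub _ xK.
  case: xK => xv xp; exists (edge_at x n).
  have [_ r o] := phiP (edge_at x n).
  have oE : kedge_off (phi (edge_at x n)) = kedge_off K.
    by rewrite o -xp posS p0.
  have rE : rng _ (phi (edge_at x n)) = rng _ K by rewrite r -vtxS.
  apply: (@kedge_le_anti _ _ _ (P n) (P n.+1)); rewrite /kedge_le oE leqnn !andbT.
  by apply/andP; split; apply/eqP; [exact: rE|exact/esym/rE].
pose psi K := projT1 (cid (phi_onto K)).
have psiP K : phi (psi K) = K := projT2 (cid (phi_onto K)).
exists phi; split => // [|e|e]; try by case: (phiP e).
by exists psi => // e; apply: phi_inj.
Qed.

Theorem lemma3p9 (R : realType) (B : obd) :
  (exists X : sds R, obd_iso B (bratteli X)) <-> properly_ordered B.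
Proof.
split=> [[X [f [g [fg _]]]]|[[pmax [[maxp maxe] maxu]] [pmin [[minp mine] minu]]]].
  have gf : premor_equiv (premor_comp f g) (premor_id B).
    rewrite -[premor_equiv _ _]/(premor_class _ _) fg; exact: premor_equiv_id.
  have cB b := contracting_retract gf (@contracting_bratteli R X b).
  by split; [exact: contracting_path (cB true)|exact: contracting_path (cB false)].
pose xmax : ipath B := exist _ pmax maxp.
pose xmin : ipath B := exist _ pmin minp.
have xmaxP x : (forall n, at_top x n) <-> x = xmax.
  split=> [/all_top h|->]; last exact/all_top.
  apply: ipath_eq => n; rewrite {2}/edge_at /= (maxu (sval x)) //.
  by split => //; exact: (svalP x).
have xminP x : (forall n, pos x n = 0%N) <-> x = xmin.
  split=> [/all_bottom h|->]; last exact/all_bottom.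
  apply: ipath_eq => n; rewrite {2}/edge_at /= (minu (sval x)) //.
  by split => //; exact: (svalP x).
exists (path_sds xmaxP xminP R).
by apply: obd_iso_same_vert => n; exact: path_kedges.
Qed.
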